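(* Let $k$ be an algebraically closed field and let $R$ be a finite-dimensional Frobenius $k$-algebra with bilinear form $\langle\,,\,\rangle$ and Nakayama automorphism $\nu$. Then the operator $\Delta$ induces a BV-algebra structure on the Gerstenhaber algebra $(\mathrm{HH}^*(R)^{\nu\uparrow},\smile,[\,,\,])$; that is, the induced operator $\Delta:\mathrm{HH}^*(R)^{\nu\uparrow}\to\mathrm{HH}^{*-1}(R)^{\nu\uparrow}$ satisfies $\Delta\circ\Delta=0$ and $$[a,b]=-(-1)^{(|a|-1)|b|}\big(\Delta(a\smile b)-\Delta(a)\smile b-(-1)^{|a|}a\smile\Delta(b)\big)$$ for all homogeneous $a,b\in\mathrm{HH}^*(R)^{\nu\uparrow}$.
   Context: Notation: $\otimes=\otimes_k$. $R$ is Frobenius: there is a linear map $\epsilon:R\to k$ such that $\langle a,b\rangle=\epsilon(ab)$ is nondegenerate; the Nakayama automorphism $\nu$ is the algebra automorphism with $\langle a,b\rangle=\langle b,\nu(a)\rangle$ for all $a,b\in R$. Hochschild cochains: $C^n(R)=\mathrm{Hom}_k(R^{\otimes n},R)$ ($C^0(R)=R$), with the Hochschild differential $\delta_n:C^n(R)\to C^{n+1}(R)$, $$\delta_n(f)(a_1\otimes\dots\otimes a_{n+1})=a_1f(a_2\otimes\dots\otimes a_{n+1})+\sum_{i=1}^n(-1)^if(a_1\otimes\dots\otimes a_ia_{i+1}\otimes\dots\otimes a_{n+1})+(-1)^{n+1}f(a_1\otimes\dots\otimes a_n)a_{n+1}.$$ Cup product: for $f\in C^n(R)$, $g\in C^m(R)$,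 $(f\smile g)(a_1\otimes\dots\otimes a_{n+m})=f(a_1\otimes\dots\otimes a_n)\,g(a_{n+1}\otimes\dots\otimes a_{n+m})$. Bracket: for $n\ge1$ and $1\le i\le n$ let $(f\circ_ig)(a_1\otimes\dots\otimes a_{n+m-1})=f(a_1\otimes\dots\otimes a_{i-1}\otimes g(a_i\otimes\dots\otimes a_{i+m-1})\otimes a_{i+m}\otimes\dots\otimes a_{n+m-1})$ (if $m=0$, the element $g\in R$ is inserted in position $i$); $f\circ g=\sum_{i=1}^n(-1)^{(m-1)(i-1)}f\circ_ig$ (zero if $n=0$); $[f,g]=f\circ g-(-1)^{(n-1)(m-1)}g\circ f\in C^{n+m-1}(R)$. For $f\in C^n(R)$ put $f^{\nu}(a_1\otimes\dots\otimes a_n)=\nu^{-1}\big(f(\nu(a_1)\otimes\dots\otimes\nu(a_n))\big)$; this commutes with $\delta_n$. Let $C^n(R)^{\nu}=\{f\in C^n(R)\mid f^{\nu}=f\}$, let $\delta_n^\nu$ be the restriction of $\delta_n$ to $C^n(R)^\nu$, and let $\mathrm{HH}^n(R)^{\nu\uparrow}=\ker(\delta_n^{\nu})/\mathrm{Im}(\delta_{n-1}^{\nu})$, $\mathrm{HH}^*(R)^{\nu\uparrow}=\bigoplus_{n\ge0}\mathrm{HH}^n(R)^{\nu\uparrow}$. The operations $\smile$ and $[\,,\,]$ above induce a Gerstenhaber algebra structure on $\mathrm{HH}^*(R)^{\nu\uparrow}$. For $n\ge1$, $f\in C^n(R)$, $1\le i\le n$, define $\Delta_if\in C^{n-1}(R)$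 by $$\langle\Delta_if(a_1\otimes\dots\otimes a_{n-1}),a_n\rangle=\langle f(a_i\otimes\dots\otimes a_{n-1}\otimes a_n\otimes\nu a_1\otimes\dots\otimes\nu a_{i-1}),1\rangle$$ and $\Delta=\sum_{i=1}^n(-1)^{i(n-1)}\Delta_i:C^n(R)\to C^{n-1}(R)$ ($\Delta=0$ on $C^0(R)$). The map $\Delta$ induces maps $\mathrm{HH}^n(R)^{\nu\uparrow}\to\mathrm{HH}^{n-1}(R)^{\nu\uparrow}$. A BV-algebra is a Gerstenhaber algebra $(A^\bullet,\smile,[\,,\,])$ with an operator $\Delta:A^\bullet\to A^{\bullet-1}$ of degree $-1$ satisfying $\Delta\circ\Delta=0$ and the identity displayed in the claim. *)

(* Defs.v *)
From HB Require Import structures.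
From mathcomp Require Import all_boot all_order all_algebra all_field.
From mathcomp Require Import boolp classical_sets functions.

Set Implicit Arguments.
Unset Strict Implicit.
Unset Printing Implicit Defensive.

Import GRing.Theory.
Local Open Scope ring_scope.

Section QuotientLmodule.
Variables (k : nzRingType) (V : lmodType k) (W : {pred V}).
Variable W_submod : submod_closed W.

(* W, keyed by the proof that it is a submodule *)
Definition submod_pred of submod_closed W : {pred V} := W.
HB.instance Definition _ := GRing.isSubmodClosed.Build k V
  (submod_pred W_submod) W_submod.
Local Notation Q := (@Quotient.quot V (submod_pred W_submod)).

Local Open Scope quotient_scope.

Definition lmod_quot : Type := Q.

HB.instance Definition _ := GRing.Zmodule.on lmod_quot.

Definition lclass (v : V) : lmod_quot := \pi_Q v.

Lemma lclass_eq u v : lclass u = lclass v <-> u - v \in W.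
Proof.
rewrite -[_ \in W]/(_ \in submod_pred W_submod) Quotient.idealrBE.
by split=> [/eqP|/eqP].
Qed.

Lemma lclass_surj (x : lmod_quot) : exists v, x = lclass v.
Proof. by exists (repr (x : Q)); rewrite /lclass reprK. Qed.

Lemma lclassD u v : lclass (u + v) = lclass u + lclass v.
Proof. exact: (raddfD (\pi_Q)). Qed.

Definition lquot_scale (c : k) (x : lmod_quot) : lmod_quot :=
  lclass (c *: repr (x : Q)).

Lemma lclassZ c v : lquot_scale c (lclass v) = lclass (c *: v).
Proof.
apply/lclass_eq; rewrite -scalerBr.
have [W0 Wl] := W_submod; rewrite -[_ *: _]addr0 Wl //; apply/lclass_eq.
by rewrite /lclass reprK.
Qed.

Lemma lquot_scaleA c d x :
  lquot_scale c (lquot_scale d x) = lquot_scale (c * d) x.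
Proof. by have [v ->] := lclass_surj x; rewrite !lclassZ scalerA. Qed.

Lemma lquot_scale1 : left_id 1 lquot_scale.
Proof. by move=> x; have [v ->] := lclass_surj x; rewrite lclassZ scale1r. Qed.

Lemma lquot_scaleDr : right_distributive lquot_scale +%R.
Proof.
move=> c x y; have [[u ->] [v ->]] := (lclass_surj x, lclass_surj y).
by rewrite -lclassD !lclassZ scalerDr lclassD.
Qed.

Lemma lquot_scaleDl x : {morph lquot_scale^~ x : c d / c + d}.
Proof.
by move=> c d; have [v ->] := lclass_surj x; rewrite !lclassZ scalerDl lclassD.
Qed.

HB.instance Definition _ := GRing.Zmodule_isLmodule.Build k lmod_quot
  lquot_scaleA lquot_scale1 lquot_scaleDr lquot_scaleDl.

End QuotientLmodule.

Section DirectSum.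
Variables (k : nzRingType) (A : nat -> lmodType k).

(* the direct sum of the A n: families vanishing in all large degrees *)
Record dsum := DSum {
  dcoord :> forall n, A n;
  _ : `[< exists N, forall n, (N <= n)%N -> dcoord n = 0 >] }.

HB.instance Definition _ := [isSub for dcoord].
HB.instance Definition _ := gen_eqMixin dsum.
HB.instance Definition _ := gen_choiceMixin dsum.

Lemma dsumP (x : dsum) : exists N, forall n, (N <= n)%N -> x n = 0.
Proof. by case: x => x /= /asboolP. Qed.

Lemma dsum_ext (x y : dsum) : (forall n, x n = y n) -> x = y.
Proof. by move=> xy; apply: val_inj; apply: functional_extensionality_dep. Qed.

Lemma dsum_zero_subproof : `[< exists N, forall n, (N <= n)%N -> 0 = 0 :> A n >].
Proof. by apply/asboolP; exists 0%N. Qed.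
Definition dsum_zero := DSum dsum_zero_subproof.

Lemma dsum_opp_subproof (x : dsum) :
  `[< exists N, forall n, (N <= n)%N -> - x n = 0 >].
Proof.
by apply/asboolP; have [N xN] := dsumP x; exists N => n /xN ->; rewrite oppr0.
Qed.
Definition dsum_opp x := DSum (dsum_opp_subproof x).

Lemma dsum_add_subproof (x y : dsum) :
  `[< exists N, forall n, (N <= n)%N -> x n + y n = 0 >].
Proof.
apply/asboolP; have [[N xN] [M yM]] := (dsumP x, dsumP y).
exists (maxn N M) => n; rewrite geq_max => /andP[/xN-> /yM->].
by rewrite addr0.
Qed.
Definition dsum_add x y := DSum (dsum_add_subproof x y).

Lemma dsum_scale_subproof (c : k) (x : dsum) :
  `[< exists N, forall n, (N <= n)%N -> c *: x n = 0 >].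
Proof.
by apply/asboolP; have [N xN] := dsumP x; exists N => n /xN ->; rewrite scaler0.
Qed.
Definition dsum_scale c x := DSum (dsum_scale_subproof c x).

Lemma dsum_addA : associative dsum_add.
Proof. by move=> x y z; apply: dsum_ext => n /=; rewrite addrA. Qed.
Lemma dsum_addC : commutative dsum_add.
Proof. by move=> x y; apply: dsum_ext => n /=; rewrite addrC. Qed.
Lemma dsum_add0 : left_id dsum_zero dsum_add.
Proof. by move=> x; apply: dsum_ext => n /=; rewrite add0r. Qed.
Lemma dsum_addN : left_inverse dsum_zero dsum_opp dsum_add.
Proof. by move=> x; apply: dsum_ext => n /=; rewrite addNr. Qed.

HB.instance Definition _ :=
  GRing.isZmodule.Build dsum dsum_addA dsum_addC dsum_add0 dsum_addN.

Lemma dsum_scaleA c d x : dsum_scale c (dsum_scale d x) = dsum_scale (c * d) x.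
Proof. by apply: dsum_ext => n /=; rewrite scalerA. Qed.
Lemma dsum_scale1 : left_id 1 dsum_scale.
Proof. by move=> x; apply: dsum_ext => n /=; rewrite scale1r. Qed.
Lemma dsum_scaleDr : right_distributive dsum_scale +%R.
Proof. by move=> c x y; apply: dsum_ext => n /=; rewrite scalerDr. Qed.
Lemma dsum_scaleDl x : {morph dsum_scale^~ x : c d / c + d}.
Proof. by move=> c d; apply: dsum_ext => n /=; rewrite scalerDl. Qed.

HB.instance Definition _ := GRing.Zmodule_isLmodule.Build k dsum
  dsum_scaleA dsum_scale1 dsum_scaleDr dsum_scaleDl.

Definition homog_fun n (x : A n) (m : nat) : A m :=
  if eqVneq n m is EqNotNeq nm then ecast i (A i) nm x else 0.

Lemma homog_subproof n (x : A n) :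
  `[< exists N, forall m, (N <= m)%N -> homog_fun x m = 0 >].
Proof.
apply/asboolP; exists n.+1 => m nm; rewrite /homog_fun.
by case: eqVneq => // e; rewrite e ltnn in nm.
Qed.

(* the canonical injection of the degree-n component *)
Definition homog n (x : A n) : dsum := DSum (homog_subproof x).

End DirectSum.

Section Frobenius.
Variables (k : fieldType) (R : falgType k) (eps : {linear R -> k^o}).

Definition frob_form (a b : R) : k := eps (a * b).

Definition nondegenerate_form : Prop :=
  (forall a, (forall b, frob_form a b = 0) -> a = 0) /\
  (forall b, (forall a, frob_form a b = 0) -> b = 0).

Definition nakayama_automorphism (nu : 'AEnd(R)) : Prop :=
  bijective nu /\ forall a b, frob_form a b = frob_form b (nu a).

(* the element r with <r, x> = phi x for all x *)
Definition frob_repr (phi : R -> k) : R :=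
  xget 0 [set r | forall x, frob_form r x = phi x].

Lemma frob_reprP (phi : {linear R -> k^o}) :
  nondegenerate_form -> forall x, frob_form (frob_repr phi) x = phi x.
Proof.
move=> [nondeg _].
pose L (r : R) : 'Hom(R, k^o) := (linfun eps \o amull r)%VF.
have LE r x : L r x = frob_form r x by rewrite comp_lfunE !lfunE.
have L_lin : linear L.
  move=> c r s; apply/lfunP => x; rewrite add_lfunE scale_lfunE !LE /frob_form.
  by rewrite mulrDl -scalerAl linearP.
pose hL := GRing.isLinear.Build k R 'Hom(R, k^o) *:%R L L_lin.
pose LL : {linear R -> 'Hom(R, k^o)} := HB.pack L hL.
have kerL : lker (linfun LL) == 0%VS.
  apply/lker0P => r s; rewrite !lfunE /= => /lfunP rs; apply/eqP.
  rewrite -subr_eq0; apply/eqP/nondeg => x.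
  by rewrite /frob_form mulrBl linearB /= -!/(frob_form _ _) -!LE rs subrr.
have imL : limg (linfun LL) = fullv.
  apply/eqP; rewrite eqEdim subvf limg_dim_eq; last first.
    by rewrite (eqP kerL) capv0.
  by rewrite !dimvf /dim /= muln1.
have /memv_imgP[r _ rphi] : linfun phi \in limg (linfun LL).
  by rewrite imL memvf.
have [y yE] : exists y, forall x, frob_form y x = phi x.
  by exists r => x; rewrite -LE; have /lfunP/(_ x) := rphi; rewrite !lfunE.
exact: (@xgetPex _ 0 [set r | forall x, frob_form r x = phi x]
  (ex_intro _ y yE)).
Qed.

End Frobenius.

Section Hochschild.
Variables (k : fieldType) (R : falgType k).

(* Linear maps R^{(x)n} -> R are represented by multilinear functions of n
   arguments. *)
Local Notation cochain n := (n.-tuple R -> R).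

(* The value of f on a list of length n; every use below is on a list of
   length n, so that the padding by zeros plays no role. *)
Definition ev n (f : cochain n) (s : seq R) : R := f [tuple s`_i | i < n].

Definition multilinear n (f : cochain n) : Prop :=
  forall (s t : seq R) (c : k) (x y : R), (size s + size t).+1 = n ->
    ev f (s ++ (c *: x + y) :: t) =
    c *: ev f (s ++ x :: t) + ev f (s ++ y :: t).

(* Lists are indexed from 0: the entry a`_i is the argument a_{i+1}. *)
Definition hdelta n (f : cochain n) : cochain n.+1 := fun a =>
  a`_0 * ev f (behead a)
  + \sum_(i < n) (-1) ^+ i.+1 *:
      ev f (take i a ++ (a`_i * a`_i.+1) :: drop i.+2 a)
  + (-1) ^+ n.+1 *: (ev f (take n a) * a`_n).

Definition hcup n m (f : cochain n) (g : cochain m) : cochain (n + m) :=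
  fun a => ev f (take n a) * ev g (drop n a).

(* f o g, on a list of arguments of length n + m - 1.  Here i is i - 1 in the
   usual formula, and (m - 1)(i - 1) has the parity of m.+1 * i, also for
   m = 0. *)
Definition hcirc n m (f : cochain n) (g : cochain m) (a : seq R) : R :=
  \sum_(i < n) (-1) ^+ (m.+1 * i) *:
    ev f (take i a ++ ev g (take m (drop i a)) :: drop (i + m) a).

(* For n = m = 0 this is the zero 0-cochain, standing for the zero cochain of
   degree -1; the same holds for hDelta below when n = 0. *)
Definition hbracket n m (f : cochain n) (g : cochain m) : cochain (n + m).-1 :=
  fun a => hcirc f g a - (-1) ^+ (n.+1 * m.+1) *: hcirc g f a.

Section Delta.
Variables (eps : {linear R -> k^o}) (nu : 'AEnd(R)).

Definition hDelta_i n (i : nat) (f : cochain n) : cochain n.-1 := fun a =>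
  frob_repr eps (fun x =>
    frob_form eps (ev f (drop i a ++ x :: [seq nu b | b <- take i a])) 1).

(* again i here is i - 1 in the usual formula *)
Definition hDelta n (f : cochain n) : cochain n.-1 := fun a =>
  \sum_(i < n) (-1) ^+ (i.+1 * n.-1) *: hDelta_i i f a.

End Delta.

Section Cohomology.
Variable nu : 'AEnd(R).

(* nu^-1 f(nu a_1, ..., nu a_n); for bijective nu, (nu^-1)%VF is its inverse *)
Definition htwist n (f : cochain n) : cochain n := fun a =>
  (nu^-1)%VF (f (map_tuple nu a)).

(* f is in C^n(R)^nu *)
Definition nu_cochain n (f : cochain n) : Prop :=
  multilinear f /\ htwist f = f.

Definition nu_cocycle n : {pred cochain n} :=
  fun f => `[< nu_cochain f /\ hdelta f = 0 >].

Definition is_nu_coboundary n : cochain n -> Prop :=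
  match n with
  | 0 => fun f => f = 0
  | n'.+1 => fun f => exists2 h : cochain n', nu_cochain h & hdelta h = f
  end.

Lemma ev_lin n c (f g : cochain n) s : ev (c *: f + g) s = c *: ev f s + ev g s.
Proof. by []. Qed.

Lemma hdelta_lin n c (f g : cochain n) :
  hdelta (c *: f + g) = c *: hdelta f + hdelta g.
Proof.
apply/funext => a; rewrite -[RHS]/(c *: hdelta f a + hdelta g a) /hdelta.
rewrite !scalerDr [RHS]addrACA [X in _ = X + _]addrACA !ev_lin; congr (_ + _ + _).
- by rewrite mulrDr -scalerAr.
- rewrite scaler_sumr -big_split /=; apply: eq_bigr => i _.
  by rewrite ev_lin scalerDr !scalerA mulrC.
- by rewrite mulrDl -scalerAl scalerDr !scalerA mulrC.
Qed.

Lemma hdelta0 n : hdelta (0 : cochain n) = 0.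
Proof.
by have := @hdelta_lin n (-1) 0 0; rewrite scaler0 addr0 scaleN1r addNr.
Qed.

Lemma htwist_lin n c (f g : cochain n) :
  htwist (c *: f + g) = c *: htwist f + htwist g.
Proof. by apply/funext => a; rewrite /htwist linearP. Qed.

Lemma nu_cochain0 n : nu_cochain (0 : cochain n).
Proof.
split=> [s t c x y _|]; first by rewrite /ev /= scaler0 addr0.
by apply/funext => a; rewrite /htwist linear0.
Qed.

Lemma nu_cochain_lin n c (f g : cochain n) :
  nu_cochain f -> nu_cochain g -> nu_cochain (c *: f + g).
Proof.
move=> [mf tf] [mg tg]; split; last by rewrite htwist_lin tf tg.
move=> s t d x y st; rewrite !ev_lin mf // mg // !scalerDr !scalerA mulrC.
by rewrite !addrA; congr (_ + _); rewrite -!addrA; congr (_ + _); rewrite addrC.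
Qed.

Lemma nu_cocycle_submod n : submod_closed (@nu_cocycle n).
Proof.
split=> [|c f g /asboolP[cf df] /asboolP[cg dg]]; apply/asboolP.
  by split; [exact: nu_cochain0 | exact: hdelta0].
split; first exact: nu_cochain_lin.
by rewrite hdelta_lin df dg scaler0 addr0.
Qed.

HB.instance Definition _ n :=
  GRing.isSubmodClosed.Build k (n.-tuple R -> R) (@nu_cocycle n)
    (nu_cocycle_submod n).

(* ker delta_n^nu *)
Record cocycles n := Cocycle {
  cocycle_val :> cochain n;
  _ : cocycle_val \in @nu_cocycle n }.

HB.instance Definition _ n := [isSub for @cocycle_val n].
HB.instance Definition _ n := gen_eqMixin (cocycles n).
HB.instance Definition _ n := gen_choiceMixin (cocycles n).
HB.instance Definition _ n := [SubChoice_isSubLmodule of cocycles n by <:].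

(* Im delta_{n-1}^nu, inside ker delta_n^nu *)
Definition coboundaries n : {pred cocycles n} :=
  fun z => `[< is_nu_coboundary (cocycle_val z) >].

Lemma coboundaries_submod n : submod_closed (@coboundaries n).
Proof.
split=> [|c y z /asboolP By /asboolP Bz]; apply/asboolP.
  by case: n => // n; exists 0; [exact: nu_cochain0 | exact: hdelta0].
rewrite -[cocycle_val _]/(c *: cocycle_val y + cocycle_val z).
case: n y z By Bz => [|n] y z /=; first by move=> -> ->; rewrite scaler0 addr0.
move=> [f cf <-] [g cg <-]; exists (c *: f + g); last exact: hdelta_lin.
exact: nu_cochain_lin.
Qed.

Definition HH n : lmodType k := lmod_quot (@coboundaries_submod n).

Definition HHtot := dsum HH.

Definition HHin n (x : HH n) : HHtot := homog x.

Definition hclass n (z : cocycles n) : HH n := lclass (@coboundaries_submod n) z.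

(* f is a nu-invariant cocycle whose class is x.  Every class has such an f, so
   a map on HH is determined by its effect on representing cocycles. *)
Definition represents n (x : HH n) (f : cochain n) : Prop :=
  exists2 z : cocycles n, cocycle_val z = f & hclass z = x.

Lemma represents_ex n (x : HH n) : exists f, represents x f.
Proof.
have [z xE] := lclass_surj x.
by exists (cocycle_val z); exists z => //; rewrite xE.
Qed.

Lemma represents_eq n (x y : HH n) (f g : cochain n) :
  represents x f -> represents y g ->
  (x = y <-> is_nu_coboundary (f - g)).
Proof.
move=> [u <- <-] [v <- <-]; rewrite /hclass lclass_eq.
by split=> [/asboolP|?]; last exact/asboolP.
Qed.

End Cohomology.
End Hochschild.

(* Main.v *)
Require Import Defs.
From HB Require Import structures.
From mathcomp Require Import all_boot all_order all_algebra all_field.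
From mathcomp Require Import zify.
From mathcomp Require Import boolp functions.

Set Implicit Arguments.
Unset Strict Implicit.
Unset Printing Implicit Defensive.

Import GRing.Theory.
Local Open Scope ring_scope.

(** Write <a, b> = eps (a b) and let [f] and [g] be nu-invariant cochains of
    degrees n and m. As the form is nondegenerate, a cochain h is determined by
    its functional (s, a) |-> <h s, a> on words s a, and every multilinear
    functional is of this kind, so that primitives of coboundaries can be
    prescribed as functionals. Seen in this way, Delta f is the signed sum of
    eps f over all rotations of the cyclic word s a, where nu is applied to the
    letters carried past the end ([pairing_hDelta]). By the Nakayama relation
    and the invariance of [f], cutting the word elsewhere changes only the sign.
    The identities hold for cocycles up to explicit homotopies that commute with
    nu, hence in the cohomology of the complex of nu-invariant cochains, over
    any field.

    Operations on cochains become sums over the ways of cutting a list. The main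
    one is the insertion of [g] into another function. It is a coderivation for
    cutting, the commutator of two insertions is an insertion
    ([insert_insert]), and the multiplication of neighbours is itself the
    insertion of the product of the algebra. Hence this contraction commutes
    with the insertion of a cocycle ([contract_insert]).

    Delta anticommutes with the differential: contraction commutes with rotation
    ([formdiff_rotsum]), and the outer terms a f(..) and f(..) a of the
    differential cancel around the circle ([rotsum_conv_letter]).

    The square of Delta vanishes on normalised cochains, but not on all of them.
    If [f] is a cocycle and g = Delta f, the rotations of eps g(1, ..) form a
    primitive of Delta g ([formdiff_rotsum_cons1]).

    For the BV identity, Delta of a cup product is split according to whether
    the last letter a is an argument of [f] or of [g] ([rotsum_conv]). Consider
    the sum of eps f(.., g(..), .., a, ..) over all rotations, with g(..) to the
    left of a. Since [f] and [g] are cocycles, only three kinds of terms survive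
    in its differential: g(..) leaves [f], which gives the part of Delta of the
    cup product with a in [f]; a leaves [f], which gives f o g; and g(..) is
    multiplied by a, which gives the cup product of Delta f with [g]
    ([formdiff_cycsum_insert_form]). The same with [f] and [g] exchanged gives
    the other part, g o f and the product of Delta g with [f]; the latter is
    commuted into the product of [f] with Delta g by Gerstenhaber's homotopy
    ([hdiff_insert]). Adding up yields [bv_identity]. *)

(** * Linear identities in an abelian group *)

Inductive zexpr := ZAtom of nat | ZZero | ZOpp of zexpr | ZAdd of zexpr & zexpr.

Fixpoint zeval (V : zmodType) (env : seq V) e : V :=
  match e with
  | ZAtom i => env`_i
  | ZZero => 0
  | ZOpp e => - zeval env e
  | ZAdd e1 e2 => zeval env e1 + zeval env e2
  end.

Fixpoint zcoef e i : int :=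
  match e with
  | ZAtom j => (i == j)%:R
  | ZZero => 0
  | ZOpp e => - zcoef e i
  | ZAdd e1 e2 => zcoef e1 i + zcoef e2 i
  end.

Lemma zevalE (V : zmodType) (env : seq V) e :
  zeval env e = \sum_(i < size env) env`_i *~ zcoef e i.
Proof.
elim: e => [j||e IH|e1 IH1 e2 IH2] /=.
- have [jlt|jge] := ltnP j (size env); last first.
    rewrite nth_default // big1 // => i _.
    by rewrite (ltn_eqF (leq_trans (ltn_ord i) jge)).
  rewrite (bigD1 (Ordinal jlt)) //= eqxx big1 ?addr0 // => i ij.
  by have /negbTE -> : (i : nat) != j by [].
- by rewrite big1.
- by rewrite IH -sumrN; apply: eq_bigr => i _; rewrite mulrNz.
- by rewrite IH1 IH2 -big_split; apply: eq_bigr => i _; rewrite mulrzDr.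
Qed.

(** Two terms are equal as soon as every atom has the same integer coefficient
    in both; on reified terms this is decided by computation. *)
Lemma zexpr_eq (V : zmodType) (env : seq V) e1 e2 :
  all (fun i => zcoef e1 i == zcoef e2 i) (iota 0 (size env)) ->
  zeval env e1 = zeval env e2.
Proof.
move=> /allP eqc; rewrite !zevalE; apply: eq_bigr => i _.
by rewrite (eqP (eqc i _)) // mem_iota ltn_ord.
Qed.

(* Atoms that agree only up to conversion are identified. *)
Ltac zindex x env :=
  match env with
  | ?y :: ?env' =>
    let _ := match goal with _ => first [constr_eq x y | unify x y] end in
    constr:(0%N)
  | ?y :: ?env' => let i := zindex x env' in constr:(S i)
  end.

Ltac zatoms x env :=
  lazymatch x with
  | ?a + ?b => let env := zatoms a env in zatoms b env
  | - ?a => zatoms a env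
  | 0 => env
  | _ => match goal with
         | _ => let _ := zindex x env in env
         | _ => constr:(x :: env)
         end
  end.

Ltac zreify x env :=
  lazymatch x with
  | ?a + ?b => let e1 := zreify a env in
               let e2 := zreify b env in constr:(ZAdd e1 e2)
  | - ?a => let e := zreify a env in constr:(ZOpp e)
  | 0 => constr:(ZZero)
  | _ => let i := zindex x env in constr:(ZAtom i)
  end.

Ltac zmod :=
  lazymatch goal with
  | |- @eq ?V ?x ?y =>
    let env := zatoms x (@nil V) in
    let env := zatoms y env in
    let e1 := zreify x env in
    let e2 := zreify y env in
    exact: (@zexpr_eq _ env e1 e2 isT)
  end.

(** * Sums over the ways of cutting a list *)

Section SumOverSplittings.
Variables (T : Type) (V : zmodType).
Implicit Types (F G : seq T -> seq T -> V) (s t u v w : seq T).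

Definition cutsum F s : V := \sum_(i < (size s).+1) F (take i s) (drop i s).

Lemma eq_cutsum F G s :
  (forall u v, s = u ++ v -> F u v = G u v) -> cutsum F s = cutsum G s.
Proof. by move=> FG; apply: eq_bigr => i _; apply: FG; rewrite cat_take_drop. Qed.

Lemma cutsum_nil F : cutsum F [::] = F [::] [::].
Proof. by rewrite /cutsum big_ord1. Qed.

Lemma cutsum_cons F a s :
  cutsum F (a :: s) = F [::] (a :: s) + cutsum (fun u v => F (a :: u) v) s.
Proof. by rewrite /cutsum big_ord_recl. Qed.

(** The cut falls before or after the letter [c]. This is how a letter produced
    by an operation is followed through later cuts. *)
Lemma cutsum_cat_cons F u c w :
  cutsum F (u ++ c :: w) = cutsum (fun u1 u2 => F u1 (u2 ++ c :: w)) u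
                       + cutsum (fun w1 w2 => F (u ++ c :: w1) w2) w.
Proof.
elim: u F => [|a u IH] F /=; first by rewrite cutsum_cons cutsum_nil.
by rewrite !cutsum_cons IH addrA.
Qed.

Lemma cutsum0 s : cutsum (fun _ _ => 0) s = 0.
Proof. by rewrite /cutsum big1. Qed.

Lemma cutsum_eq0 F s : (forall u v, s = u ++ v -> F u v = 0) -> cutsum F s = 0.
Proof. by move=> F0; rewrite (eq_cutsum F0) cutsum0. Qed.

Lemma cutsumD F G s :
  cutsum (fun u v => F u v + G u v) s = cutsum F s + cutsum G s.
Proof. exact: big_split. Qed.

Lemma cutsumN F s : cutsum (fun u v => - F u v) s = - cutsum F s.
Proof. by rewrite /cutsum sumrN. Qed.

Lemma cutsumB F G s :
  cutsum (fun u v => F u v - G u v) s = cutsum F s - cutsum G s.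
Proof. by rewrite cutsumD cutsumN. Qed.

(** Both sides run over the ways of cutting [s] into three pieces. *)
Lemma cutsum_assoc (F : seq T -> seq T -> seq T -> V) s :
  cutsum (fun u v => cutsum (fun u1 u2 => F u1 u2 v) u) s =
  cutsum (fun u v => cutsum (F u) v) s.
Proof.
elim: s F => [|a s IH] F; first by rewrite !cutsum_nil.
rewrite !cutsum_cons cutsum_nil -addrA -IH -cutsumD; congr (_ + _).
by apply: eq_cutsum => u v _; rewrite cutsum_cons.
Qed.

Lemma cutsum_nill F s : (forall a u v, F (a :: u) v = 0) -> cutsum F s = F [::] s.
Proof.
by case: s => [|a s] F0; rewrite ?cutsum_nil // cutsum_cons cutsum_eq0 ?addr0.
Qed.

Lemma cutsum_nilr F s : (forall u b v, F u (b :: v) = 0) -> cutsum F s = F s [::].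
Proof.
elim: s F => [|a s IH] F F0; first exact: cutsum_nil.
by rewrite cutsum_cons F0 add0r IH.
Qed.

End SumOverSplittings.

Lemma cutsum_exchange (T T' : Type) (V : zmodType)
    (F : seq T -> seq T -> seq T' -> seq T' -> V) s t :
  cutsum (fun u v => cutsum (F u v) t) s = cutsum (fun x y =>
    cutsum (fun u v => F u v x y) s) t.
Proof. exact: exchange_big. Qed.

Lemma cutsum_map (T T' : Type) (V : zmodType) (h : T -> T')
    (F : seq T' -> seq T' -> V) s :
  cutsum F (map h s) = cutsum (fun u v => F (map h u) (map h v)) s.
Proof.
by rewrite /cutsum size_map; apply: eq_bigr => i _; rewrite map_take map_drop.
Qed.

Lemma cutsumZ (k : nzRingType) (T : Type) (V : lmodType k) (F : seq T ->
  seq T -> V) c s :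
  cutsum (fun u v => c *: F u v) s = c *: cutsum F s.
Proof. by rewrite /cutsum scaler_sumr. Qed.

Lemma raddf_cutsum (T : Type) (V W : zmodType) (h : {additive V -> W})
    (F : seq T -> seq T -> V) s :
  h (cutsum F s) = cutsum (fun u v => h (F u v)) s.
Proof. exact: raddf_sum. Qed.

(** * Signs *)

Lemma sgn_eq (k : pzRingType) a b : odd a = odd b -> (-1) ^+ a = (-1) ^+ b :> k.
Proof. by rewrite -signr_odd => ->; rewrite signr_odd. Qed.

Lemma sgnZ (k : pzRingType) (V : lmodType k) a b (x : V) :
  odd a = odd b -> (-1) ^+ a *: x = (-1) ^+ b *: x.
Proof. by move/(@sgn_eq k) ->. Qed.

Lemma sgnZK (k : pzRingType) (V : lmodType k) a (x : V) :
  (-1) ^+ a *: ((-1) ^+ a *: x) = x.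
Proof. by rewrite scalerA -expr2 sqrr_sign scale1r. Qed.

Lemma size_cons T (x : T) s : size (x :: s) = (size s).+1.
Proof. by []. Qed.

(* Exponents are expanded into sums of monomials, so that only the parities of
   the variables are left. *)
Ltac parity :=
  rewrite ?(size_cat, size_map, size_cons)
    ?(mul0n, muln0, mulSn, mulnS, mulnDl, mulnDr, addSn, addnS, add0n, addn0)
    ?(oddS, oddD, oddM) /=;
  by repeat match goal with |- context [odd ?n] => case: (odd n) end.

Ltac sgn := rewrite ?scalerA -?exprD; apply: sgnZ; parity.

Lemma sgnE (k : pzRingType) (V : lmodType k) a (x : V) :
  (-1) ^+ a *: x = if odd a then - x else x.
Proof. by rewrite -signr_odd; case: odd; rewrite ?scaleN1r ?scale1r. Qed.

(* For identities between signed sums: once the parities are fixed, they are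
   identities in an abelian group. *)
Ltac lin :=
  rewrite ?sgnE ?scaleN1r ?(size_cat, size_map, size_cons)
    ?(mul0n, muln0, mulSn, mulnS, mulnDl, mulnDr, addSn, addnS, add0n, addn0)
    ?(oddS, oddD, oddM) /=;
  repeat match goal with |- context [odd ?n] => case: (odd n) end;
  rewrite /=; zmod.

(** * Insertion of one operation into another *)

Section Insertion.
Variables (k : comNzRingType) (A : algType k).
Implicit Types (j l m n : nat) (g h : seq A -> A) (s t u v w : seq A).

Definition multilin (V : lmodType k) (F : seq A -> V) : Prop :=
  forall u w c x y,
    F (u ++ (c *: x + y) :: w) = c *: F (u ++ x :: w) + F (u ++ y :: w).

Definition supported (V : zmodType) m (F : seq A -> V) : Prop :=
  forall s, size s != m -> F s = 0.

(** The composition f o g is [insert m g f] for [g] of degree [m]. Functionals are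
    allowed as [F] too, and [m] enters only through its parity: [m.+1] replaces
    m - 1. *)
Definition insert (V : lmodType k) m g (F : seq A -> V) s : V :=
  cutsum (fun u t => cutsum (fun x w =>
    (-1) ^+ (m.+1 * size u) *: F (u ++ g x :: w)) t) s.

Section Multilinear.
Variables (V : lmodType k) (F : seq A -> V).
Hypothesis mF : multilin F.

Lemma multilinD u w x y :
  F (u ++ (x + y) :: w) = F (u ++ x :: w) + F (u ++ y :: w).
Proof. by rewrite -[x]scale1r mF !scale1r. Qed.

Lemma multilin0 u w : F (u ++ 0 :: w) = 0.
Proof. by apply: (addrI (F (u ++ 0 :: w))); rewrite -multilinD !addr0. Qed.

Lemma multilinZ u w c x : F (u ++ (c *: x) :: w) = c *: F (u ++ x :: w).
Proof. by rewrite -[c *: x]addr0 mF multilin0 addr0. Qed.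

Lemma multilin_entry_cutsum u w (T : Type) (G : seq T -> seq T -> A) (s : seq T) :
  F (u ++ cutsum G s :: w) = cutsum (fun x y => F (u ++ G x y :: w)) s.
Proof.
rewrite /cutsum; elim/big_rec2: _ => [|i y x _ <-]; first exact: multilin0.
by rewrite multilinD.
Qed.

Lemma multilin_catl u : multilin (fun s => F (u ++ s)).
Proof. by move=> u' w c x y; rewrite !catA mF. Qed.

Lemma multilin_catr w : multilin (fun s => F (s ++ w)).
Proof. by move=> u w' c x y; rewrite -!catA /= mF. Qed.

End Multilinear.

Lemma eq_insert (V : lmodType k) m g (F G : seq A -> V) :
  F =1 G -> insert m g F =1 insert m g G.
Proof.
by move=> FG s; apply: eq_cutsum => u t _; apply: eq_cutsum => x w _; rewrite FG.
Qed.

(** The output of [g] is one letter, so a cut never splits it and the piece that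
    [g] reads lies on one side of the cut: insertion is a coderivation for
    deconcatenation. *)
Lemma insert_cutsum (V : lmodType k) m g (F : seq A -> seq A -> V) s :
  insert m g (cutsum F) s =
  cutsum (fun u v => insert m g (fun x => F x v) u
                 + (-1) ^+ (m.+1 * size u) *: insert m g (F u) v) s.
Proof.
rewrite /insert.
under eq_cutsum => u t _ do under eq_cutsum do rewrite cutsum_cat_cons scalerDr
  -2!cutsumZ.
under eq_cutsum => u t _ do rewrite cutsumD.
rewrite cutsumD addrC [RHS]cutsumD; congr (_ + _).
  rewrite cutsum_assoc; apply: eq_cutsum => u v _.
  by rewrite cutsum_assoc.
pose G q x t := cutsum (fun y w =>
  (-1) ^+ (m.+1 * size (q ++ x)) *: F q (x ++ g y :: w)) t.
transitivity (cutsum (fun u t => cutsum (fun q x => G q x t) u) s).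
  apply: eq_cutsum => u t _; rewrite cutsum_exchange.
  by apply: eq_cutsum => q x ->.
rewrite cutsum_assoc; apply: eq_cutsum => u v _; rewrite {}/G.
rewrite -cutsumZ; apply: eq_cutsum => q t _.
rewrite -cutsumZ; apply: eq_cutsum => x w _.
by rewrite scalerA size_cat mulnDr exprD.
Qed.

(** The piece read by [g] lies before [c], lies after [c], or contains [c]. *)
Lemma insert_cat_cons (V : lmodType k) m g (F : seq A -> V) u c w :
  insert m g F (u ++ c :: w) =
  insert m g (fun x => F (x ++ c :: w)) u
  + (-1) ^+ (m.+1 * (size u).+1) *: insert m g (fun y => F (u ++ c :: y)) w
  + cutsum (fun u1 u2 => cutsum (fun w1 w2 =>
      (-1) ^+ (m.+1 * size u1) *: F (u1 ++ g (u2 ++ c :: w1) :: w2)) w) u.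
Proof.
rewrite /insert cutsum_cat_cons -[RHS]addrA [X in _ = _ + X]addrC [RHS]addrA.
congr (_ + _).
  rewrite -cutsumD; apply: eq_cutsum => u1 u2 _; rewrite cutsum_cat_cons;
    congr (_ + _).
  by apply: eq_cutsum => x y _; rewrite -catA.
rewrite -cutsumZ; apply: eq_cutsum => u1 t _; rewrite -cutsumZ;
  apply: eq_cutsum => x y _.
by rewrite -catA; sgn.
Qed.

(** A sign that depends only on the length of the list passes through the
    insertion, which changes that length by m - 1. *)
Lemma insert_sgn (V : lmodType k) m g (F : seq A -> V) j s :
  multilin F -> supported m g ->
  insert m g (fun t => (-1) ^+ (j * size t) *: F t) s =
  (-1) ^+ (j * (size s + m.+1)) *: insert m g F s.
Proof.
move=> mF sg; rewrite -cutsumZ; apply: eq_cutsum => u t ->.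
rewrite -cutsumZ; apply: eq_cutsum => x w ->.
have [xm|/sg ->] := eqVneq (size x) m; last by rewrite multilin0 // !scaler0.
by rewrite -!xm; sgn.
Qed.

Lemma insert_lin (V : lmodType k) m g (F G : seq A -> V) c s :
  insert m g (fun t => c *: F t + G t) s = c *: insert m g F s + insert m g G s.
Proof.
rewrite -cutsumZ -cutsumD; apply: eq_cutsum => u t _; rewrite -cutsumZ -cutsumD.
by apply: eq_cutsum => x w _; rewrite scalerDr !scalerA mulrC.
Qed.

Lemma insertD (V : lmodType k) m g (F G : seq A -> V) s :
  insert m g (fun t => F t + G t) s = insert m g F s + insert m g G s.
Proof.
rewrite -[insert m g F s]scale1r -insert_lin; apply: eq_insert => t.
by rewrite scale1r.
Qed.

Lemma insert0 (V : lmodType k) m g s : insert m g (fun _ => 0 : V) s = 0.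
Proof.
by apply: cutsum_eq0 => u t _; apply: cutsum_eq0 => x w _; rewrite scaler0.
Qed.

Lemma insertZ (V : lmodType k) m g (F : seq A -> V) c s :
  insert m g (fun t => c *: F t) s = c *: insert m g F s.
Proof.
rewrite -[RHS]addr0 -[X in _ + X](insert0 V m g s) -insert_lin.
by apply: eq_insert => t; rewrite addr0.
Qed.

Lemma insertN (V : lmodType k) m g (F : seq A -> V) s :
  insert m g (fun t => - F t) s = - insert m g F s.
Proof.
by rewrite -scaleN1r -insertZ; apply: eq_insert => t; rewrite scaleN1r.
Qed.

Lemma multilin_insert (V : lmodType k) m g (F : seq A -> V) :
  multilin F -> multilin g -> multilin (insert m g F).
Proof.
move=> mF mlg u w c x y; rewrite !insert_cat_cons !scalerDr.
rewrite [RHS]addrACA [X in _ = X + _]addrACA; congr (_ + _ + _).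
- by rewrite -insert_lin; apply: eq_insert => t; rewrite mF.
- rewrite scalerA mulrC -scalerA -scalerDr -insert_lin; congr (_ *: _).
  by apply: eq_insert => t; rewrite mF.
- rewrite -cutsumZ -cutsumD; apply: eq_cutsum => u1 u2 _;
  rewrite -cutsumZ -cutsumD.
  apply: eq_cutsum => w1 w2 _; rewrite mlg mF.
  by rewrite scalerDr !scalerA mulrC.
Qed.

Lemma multilin_cutsum (V : lmodType k) (F : seq A -> seq A -> V) :
  (forall v, multilin (F^~ v)) -> (forall u, multilin (F u)) ->
    multilin (cutsum F).
Proof.
move=> F1 F2 u w c x y; rewrite !cutsum_cat_cons scalerDr [RHS]addrACA.
by rewrite -!cutsumZ -!cutsumD; congr (_ + _); apply: eq_cutsum => u1 u2 _;
  rewrite (F1, F2).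
Qed.

(** The exponent for [g] counts letters of the original list, in which [h x]
    occupies [l] places. *)
Definition insert2 (V : lmodType k) l h m g (F : seq A -> V) s : V :=
  cutsum (fun u t => cutsum (fun x t => cutsum (fun v t => cutsum (fun y w =>
   (-1) ^+ (l.+1 * size u + m.+1 * (size u + l + size v)) *:
     F (u ++ h x :: v ++ g y :: w)) t) t) t) s.

(** The piece read by [g] contains the output of [h], or lies to its left, or to
    its right. The last two contributions also occur, with the roles exchanged,
    when the two insertions are made in the opposite order; so the graded
    commutator of two insertions is again an insertion. *)
Lemma insert_insert (V : lmodType k) l h m g (F : seq A -> V) s :
  multilin F -> supported l h -> supported m g ->
  insert l h (insert m g F) s =
    insert (l + m).+1 (insert l h g) F s
    + insert2 m g l h F s
    + (-1) ^+ (l.+1 * m.+1) *: insert2 l h m g F s.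
Proof.
move=> mF sh sg.
rewrite {1}/insert.
under eq_cutsum => u t _ do under eq_cutsum => x w _ do
  rewrite insert_cat_cons !scalerDr.
under eq_cutsum do rewrite !cutsumD.
rewrite !cutsumD [LHS]addrC [LHS]addrA; congr (_ + _ + _).
(* [g] reads the output of [h]. *)
- pose G u1 u2 t := cutsum (fun x w => cutsum (fun w1 w2 =>
    (-1) ^+ (l.+1 * size (u1 ++ u2) + m.+1 * size u1) *:
      F (u1 ++ g (u2 ++ h x :: w1) :: w2)) w) t.
  transitivity (cutsum (fun u t => cutsum (fun u1 u2 => G u1 u2 t) u) s).
    apply: eq_cutsum => u t _; rewrite /G [RHS]cutsum_exchange.
    apply: eq_cutsum => x w _; rewrite -cutsumZ; apply: eq_cutsum => u1 u2 ->.
    by rewrite -cutsumZ; apply: eq_cutsum => w1 w2 _; sgn.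
  rewrite cutsum_assoc; apply: eq_cutsum => u1 t _.
  rewrite {}/G.
  transitivity (cutsum (fun y w2 => cutsum (fun u2 t => cutsum (fun x w1 =>
    (-1) ^+ (l.+1 * size (u1 ++ u2) + m.+1 * size u1) *:
      F (u1 ++ g (u2 ++ h x :: w1) :: w2)) t) y) t).
    rewrite cutsum_assoc; apply: eq_cutsum => u2 t2 _.
    by rewrite cutsum_assoc.
  apply: eq_cutsum => y w2 _; rewrite multilin_entry_cutsum // -cutsumZ.
  apply: eq_cutsum => u2 t2 _; rewrite multilin_entry_cutsum // -cutsumZ.
  by apply: eq_cutsum => x w _; rewrite multilinZ //; sgn.
(* [g] to the left of [h]. *)
- pose G q r t := cutsum (fun x w => cutsum (fun y z =>
    (-1) ^+ (l.+1 * size (q ++ r) + m.+1 * size q) *: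
      F (q ++ g y :: z ++ h x :: w)) r) t.
  transitivity (cutsum (fun u t => cutsum (fun q r => G q r t) u) s).
    apply: eq_cutsum => u t _; rewrite /G [RHS]cutsum_exchange.
    apply: eq_cutsum => x w _; rewrite -cutsumZ; apply: eq_cutsum => q r ->.
    by rewrite -cutsumZ; apply: eq_cutsum => y z _; rewrite -catA; sgn.
  rewrite cutsum_assoc; apply: eq_cutsum => q t _; rewrite {}/G.
  under eq_cutsum => r t' _ do rewrite cutsum_exchange.
  pose G y z t := cutsum (fun x w =>
    (-1) ^+ (l.+1 * size (q ++ y ++ z) + m.+1 * size q) *:
      F (q ++ g y :: z ++ h x :: w)) t.
  transitivity (cutsum (fun r t' => cutsum (fun y z => G y z t') r) t).
    by apply: eq_cutsum => r t' _; apply: eq_cutsum => y z ->.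
  rewrite cutsum_assoc; apply: eq_cutsum => y t' _; apply: eq_cutsum => z t'' _.
  apply: eq_cutsum => x w _.
  have [<-|/sg ->] := eqVneq (size y) m; last by rewrite multilin0 // !scaler0.
  by sgn.
(* [g] to the right of [h]. *)
- rewrite -cutsumZ; apply: eq_cutsum => u t _; rewrite -cutsumZ;
  apply: eq_cutsum => x w _.
  rewrite -!cutsumZ; apply: eq_cutsum => v t' _; rewrite -!cutsumZ;
    apply: eq_cutsum => y z _.
  have [<-|/sh ->] := eqVneq (size x) l; last by rewrite multilin0 // !scaler0.
  by sgn.
Qed.
End Insertion.

(** * Cup product and Hochschild differential on lists *)

Section Differential.
Variables (k : comNzRingType) (A : algType k).
Implicit Types (l m n : nat) (f g h : seq A -> A) (s t u v w : seq A).

Lemma insert_linl (V : lmodType k) m g h (F : seq A -> V) c s : multilin F ->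
  insert m (fun t => c *: g t + h t) F s = c *: insert m g F s + insert m h F s.
Proof.
move=> mF; rewrite -cutsumZ -cutsumD; apply: eq_cutsum => u t _;
  rewrite -cutsumZ -cutsumD.
by apply: eq_cutsum => x w _; rewrite mF scalerDr !scalerA mulrC.
Qed.

Lemma insertZl (V : lmodType k) m g (F : seq A -> V) c s : multilin F ->
  insert m (fun t => c *: g t) F s = c *: insert m g F s.
Proof.
move=> mF; rewrite -cutsumZ; apply: eq_cutsum => u t _; rewrite -cutsumZ.
by apply: eq_cutsum => x w _; rewrite multilinZ // !scalerA mulrC.
Qed.

Lemma eq_insertl (V : lmodType k) m m' g h (F : seq A -> V) s :
  odd m = odd m' -> g =1 h -> insert m g F s = insert m' h F s.
Proof.
move=> mm gh; apply: eq_cutsum => u t _; apply: eq_cutsum => x w _; rewrite gh.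
by apply: sgnZ; rewrite !oddM /= mm.
Qed.

(** The identity as a 1-cochain. As a factor it vanishes unless its piece is a
    single letter, so it marks letters in sums over cuts. *)
Definition letter s : A := if s is [:: a] then a else 0.
Definition lettermul s : A := if s is [:: a; b] then a * b else 0.

(** The cup product. *)
Definition conv f g : seq A -> A := cutsum (fun u v => f u * g v).

(** The signed sum of the products of neighbours, the dual bar differential. *)
Definition contract (V : lmodType k) (F : seq A -> V) := insert 2%N lettermul F.

(** The Hochschild differential; the sign of the last term is read off the list,
    so that no degree has to be passed. *)
Definition hdiff f s : A :=
  conv letter f s - contract f s + (-1) ^+ size s *: conv f letter s.

Lemma supported_letter : supported 1 letter.
Proof. by case=> [|a []]. Qed.

Lemma supported_lettermul : supported 2 lettermul.
Proof. by case=> [|a [|b []]]. Qed.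

Lemma multilin_conv f g : multilin f -> multilin g -> multilin (conv f g).
Proof.
move=> mf mlg; apply: multilin_cutsum => [v|u] t w c x y.
  by rewrite mf mulrDl scalerAl.
by rewrite mlg mulrDr scalerAr.
Qed.

Lemma supported_conv m n f g :
  supported n f -> supported m g -> supported (n + m) (conv f g).
Proof.
move=> sf sg s ns; apply: cutsum_eq0 => u v sE.
have [un|/sf ->] := eqVneq (size u) n; last by rewrite mul0r.
have [vm|/sg ->] := eqVneq (size v) m; last by rewrite mulr0.
by move: ns; rewrite sE size_cat un vm eqxx.
Qed.

Lemma supported_insert (V : lmodType k) m n g (F : seq A -> V) s :
  multilin F -> supported n F -> supported m g ->
    (size s).+1 != (n + m)%N -> insert m g F s = 0.
Proof.
move=> mF sF sg ns; apply: cutsum_eq0 => u t sE; apply: cutsum_eq0 => x w tE.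
have [xm|/sg ->] := eqVneq (size x) m; last by rewrite multilin0 // scaler0.
have [un|/sF ->] := eqVneq (size (u ++ g x :: w)) n; last by rewrite scaler0.
move: ns; rewrite -un -xm sE tE !size_cat /= addnS addSn eqSS.
by rewrite -!addnA [(size w + _)%N]addnC eqxx.
Qed.

Lemma lettermul_cat_cons u c w :
  lettermul (u ++ c :: w) =
  (if w is [::] then letter u * c else 0) + (if u is [::] then c * letter w
    else 0).
Proof.
case: u => [|a [|b [|? u]]]; case: w => [|a' [|b' w]] //=;
by rewrite ?(mulr0, mul0r, addr0, add0r).
Qed.

(** The two neighbours to be multiplied both lie in [u], or both in [w], or one
    of them is [c]. *)
Lemma contract_cat_cons (V : lmodType k) (F : seq A -> V) u c w : multilin F ->
  contract F (u ++ c :: w) =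
  contract (fun x => F (x ++ c :: w)) u
  + cutsum (fun u1 u2 => (-1) ^+ size u1 *: F (u1 ++ (letter u2 * c) :: w)) u
  + (-1) ^+ size u *: cutsum (fun w1 w2 => F (u ++ (c * letter w1) :: w2)) w
  - (-1) ^+ size u *: contract (fun y => F (u ++ c :: y)) w.
Proof.
move=> mF; rewrite {1}/contract insert_cat_cons.
rewrite -addrA [X in _ + X]addrC addrA; congr (_ + _); last first.
  rewrite -scalerN -[- contract _ _]scaleN1r scalerA -exprSr; sgn.
rewrite -addrA; congr (_ + _); under eq_cutsum => u1 u2 _ do
  under eq_cutsum => w1 w2 _ do rewrite lettermul_cat_cons multilinD // scalerDr.
under eq_cutsum do rewrite cutsumD.
rewrite cutsumD; congr (_ + _).
  apply: eq_cutsum => u1 u2 _; rewrite cutsum_nill => [|*];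
    last by rewrite /= multilin0 ?scaler0.
  by sgn.
rewrite cutsum_nilr => [|*]; last by apply: cutsum_eq0 => w1 w2 _;
  rewrite /= multilin0 ?scaler0.
by rewrite -cutsumZ; apply: eq_cutsum => w1 w2 _; sgn.
Qed.

(** Of the two arguments of the multiplication, one is the output of [g]. *)
Lemma insert_lettermul m g s :
  insert m g lettermul s = conv g letter s + (-1) ^+ m.+1 *: conv letter g s.
Proof.
rewrite /insert; under eq_cutsum => u t _ do
  under eq_cutsum => x w _ do rewrite lettermul_cat_cons scalerDr.
under eq_cutsum do rewrite cutsumD.
rewrite cutsumD [RHS]addrC; congr (_ + _).
  rewrite -cutsumZ; apply: eq_cutsum => u t _; rewrite cutsum_nilr => [|*];
    last exact: scaler0.
  have [uE|/supported_letter ->] := eqVneq (size u) 1%N;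
    last by rewrite mul0r !scaler0.
  by rewrite uE muln1.
rewrite cutsum_nill => [|*]; last by apply: cutsum_eq0 => w1 w2 _; exact: scaler0.
by apply: eq_cutsum => x w _; rewrite muln0 !scale1r.
Qed.

Lemma sgn_conv m n f g s : supported n f -> supported m g ->
  (-1) ^+ size s *: conv f g s = (-1) ^+ (n + m) *: conv f g s.
Proof.
move=> sf sg; have [->//|/supported_conv->//] := eqVneq (size s) (n + m)%N.
by rewrite !scaler0.
Qed.

(** The commutator of the insertion of the multiplication with that of [g] is
    an insertion by [insert_insert]. What is inserted collects the products of
    two neighbouring arguments of [g] and the products of an output of [g] with
    a neighbouring letter, that is, the Hochschild differential of [g]. *)
Lemma contract_insert (V : lmodType k) m g (F : seq A -> V) s :
  multilin F -> supported m g ->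
  contract (insert m g F) s =
  (-1) ^+ m.+1 *: insert m g (contract F) s - insert m.+1 (hdiff g) F s.
Proof.
move=> mF sg; apply/eqP; rewrite eq_sym subr_eq eq_sym addrC; apply/eqP.
have hdiffE t : hdiff g t = (-1) *: insert 2%N lettermul g t + (-1) ^+ m.+1 *:
  insert m g lettermul t.
  rewrite /hdiff insert_lettermul scalerDr sgnZK scaleN1r (sgn_conv _ sg
    supported_letter) addn1.
  by rewrite [RHS]addrA [RHS]addrC [RHS]addrA.
rewrite (eq_insertl _ _ (erefl _) hdiffE) // insert_linl // scaleN1r.
rewrite /contract (insert_insert _ mF supported_lettermul sg) (insert_insert _
  mF sg supported_lettermul).
rewrite (@eq_insertl _ (2 + m).+1 m.+1 _ (insert 2%N lettermul g) F s) //;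
  last by parity.
rewrite (@eq_insertl _ (m + 2).+1 m.+1 _ (insert m g lettermul) F s) //;
  last by parity.
rewrite insertZl // scalerDr [in RHS]scalerDr.
rewrite [(3 * m.+1)%N]mulnC (@sgn_eq _ (m.+1 * 3) m.+1); last by parity.
rewrite sgnZK addrACA [in LHS]addrA addrA addNr add0r.
by rewrite -addrA addrC.
Qed.


Lemma cutsum_mulr (F : seq A -> seq A -> A) a s :
  cutsum F s * a = cutsum (fun u v => F u v * a) s.
Proof. exact: mulr_suml. Qed.

Lemma cutsum_mull (F : seq A -> seq A -> A) a s :
  a * cutsum F s = cutsum (fun u v => a * F u v) s.
Proof. exact: mulr_sumr. Qed.

Lemma insert_mulr m g f a s :
  insert m g (fun t => f t * a) s = insert m g f s * a.
Proof.
rewrite cutsum_mulr; apply: eq_cutsum => u t _; rewrite cutsum_mulr.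
by apply: eq_cutsum => x w _; rewrite scalerAl.
Qed.

Lemma insert_mull m g f a s :
  insert m g (fun t => a * f t) s = a * insert m g f s.
Proof.
rewrite cutsum_mull; apply: eq_cutsum => u t _; rewrite cutsum_mull.
by apply: eq_cutsum => x w _; rewrite scalerAr.
Qed.

Lemma convA f g h s : conv (conv f g) h s = conv f (conv g h) s.
Proof.
rewrite /conv; under eq_cutsum do rewrite cutsum_mulr.
rewrite cutsum_assoc; apply: eq_cutsum => u t _; rewrite cutsum_mull.
by apply: eq_cutsum => x w _; rewrite mulrA.
Qed.

Lemma insert_conv m n g f h s : supported n f ->
  insert m g (conv f h) s =
  conv (insert m g f) h s + (-1) ^+ (m.+1 * n) *: conv f (insert m g h) s.
Proof.
move=> sf; rewrite insert_cutsum cutsumD -cutsumZ; congr (_ + _); apply: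
  eq_cutsum => u v _.
  by rewrite insert_mulr.
rewrite insert_mull; have [->//|/sf ->] := eqVneq (size u) n.
by rewrite mul0r !scaler0.
Qed.

Lemma insert_at_letter (V : lmodType k) m g (L : A -> V) s : L 0 = 0 ->
  insert m g (fun y => L (letter y)) s = L (g s).
Proof.
move=> L0; rewrite /insert cutsum_nill => [|a u v]; last first.
  by apply: cutsum_eq0 => x w _; rewrite supported_letter ?L0 ?scaler0 //=
    size_cat addnS.
rewrite cutsum_nilr => [|u b v]; last by rewrite L0 scaler0.
by rewrite muln0 scale1r.
Qed.

Lemma insert_letter m g s : insert m g letter s = g s.
Proof. exact: (@insert_at_letter _ m g id). Qed.

(** Gerstenhaber's formula for the differential of f o g. The cup products come
    from the two outer terms of the differential of [f], when [g] is inserted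
    into the letter that multiplies from outside. For cocycles they show that
    the cup product is graded commutative up to a coboundary. *)
Lemma hdiff_insert m n f g s : multilin f -> supported n f -> supported m g ->
  hdiff (insert m g f) s =
  (-1) ^+ m.+1 *: insert m g (hdiff f) s + insert m.+1 (hdiff g) f s
  - (-1) ^+ m.+1 *: conv g f s - (-1) ^+ (m * n.+1) *: conv f g s.
Proof.
move=> mf sf sg.
have hdiffE t : hdiff f t = conv letter f t - contract f t + (-1) ^+ n.+1 *:
  conv f letter t.
  by rewrite /hdiff (sgn_conv t sf supported_letter) addn1.
rewrite (eq_insert m g hdiffE) !insertD insertN insertZ (insert_conv _ _ _ _
  supported_letter).
rewrite (insert_conv _ _ _ _ sf).
have -> : conv (insert m g letter) f s = conv g f s by apply: eq_cutsum =>
  u v _; rewrite insert_letter.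
have -> : conv f (insert m g letter) s = conv f g s by apply: eq_cutsum =>
  u v _; rewrite insert_letter.
rewrite {1}/hdiff contract_insert //.
have sI : (-1) ^+ size s *: conv (insert m g f) letter s =
          (-1) ^+ (n + m) *: conv (insert m g f) letter s.
  have [->//|ns] := eqVneq (size s) (n + m)%N.
  suff -> : conv (insert m g f) letter s = 0 by rewrite !scaler0.
  apply: cutsum_eq0 => u v sE.
  have [v1|/supported_letter ->] := eqVneq (size v) 1%N; last by rewrite mulr0.
  by rewrite (supported_insert mf sf sg) ?mul0r // -addn1 -v1 -size_cat -sE.
rewrite sI; lin.
Qed.

Lemma conv_linl f g h c s :
  conv (fun t => c *: f t + g t) h s = c *: conv f h s + conv g h s.
Proof.
by rewrite -cutsumZ -cutsumD; apply: eq_cutsum => u v _; rewrite mulrDl scalerAl.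
Qed.

Lemma conv_linr f g h c s :
  conv f (fun t => c *: g t + h t) s = c *: conv f g s + conv f h s.
Proof.
by rewrite -cutsumZ -cutsumD; apply: eq_cutsum => u v _; rewrite mulrDr scalerAr.
Qed.

Lemma eq_conv f f' g g' : f =1 f' -> g =1 g' -> conv f g =1 conv f' g'.
Proof. by move=> ff gg s; apply: eq_cutsum => u v _; rewrite ff gg. Qed.

(** The outer terms at the cut, f(..) a times g(..) and f(..) times a g(..),
    cancel. *)
Lemma hdiff_conv m n f g s : supported n f -> supported m g ->
  hdiff (conv f g) s = conv (hdiff f) g s + (-1) ^+ n *: conv f (hdiff g) s.
Proof.
move=> sf sg.
have hdiffE i h t : supported i h ->
    hdiff h t = (-1) ^+ i.+1 *: conv h letter t + ((-1) *:
      contract h t + conv letter h t).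
  move=> sh; rewrite /hdiff (sgn_conv t sh supported_letter) addn1 scaleN1r; zmod.
rewrite (hdiffE (n + m)%N _ _ (supported_conv sf sg)).
rewrite (eq_conv (fun t => hdiffE _ _ t sf) (frefl g)).
rewrite (eq_conv (frefl f) (fun t => hdiffE _ _ t sg)).
rewrite !conv_linl !conv_linr !convA /contract (insert_conv _ _ _ _ sf).
rewrite -(convA f letter g) -(convA f g letter).
by lin.
Qed.
End Differential.
Arguments letter {k A} s.
Arguments lettermul {k A} s.
Arguments supported_letter {k A}.
Arguments supported_lettermul {k A}.

(** * Cyclic sums of functionals *)

Section Cyclic.
Variables (k : fieldType) (R : falgType k) (nu : 'AEnd(R)) (V : lmodType k).
Implicit Types (f g h : seq R -> R) (s t u v w : seq R) (a b x y : R).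
Implicit Types (Phi : seq R -> R -> seq R -> V) (psi : seq R -> R -> V).
Implicit Types (phi : seq R -> V).

(** The Hochschild differential of h as seen on the functional <h s, a>. *)
Definition formdiff psi s a : V :=
  cutsum (fun u v => psi v (a * nu (letter u))) s - contract (psi^~ a) s
  + (-1) ^+ size s *: cutsum (fun u v => psi u (letter v * a)) s.

(** The rotations v a (nu u) of the word s a, with the letter [a] kept apart.
    For a word of length n and i = |u| + 1, the exponent has the parity of
    i (n - 1). *)
Definition cycsum Phi s a : V :=
  cutsum (fun u v => (-1) ^+ ((size u).+1 * size v) *: Phi v a (map nu u)) s.

(** The contraction of the word v a w, given its values on the three parts. *)
Definition contract3 Phi v a w : V :=
  contract (fun v' => Phi v' a w) v
  + cutsum (fun v1 v2 => (-1) ^+ size v1 *: Phi v1 (letter v2 * a) w) v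
  + (-1) ^+ size v *: cutsum (fun w1 w2 => Phi v (a * letter w1) w2) w
  - (-1) ^+ size v *: contract (Phi v a) w.

Definition multilin3 Phi : Prop :=
  [/\ forall a w, multilin (fun v => Phi v a w),
      forall v a, multilin (Phi v a)
    & forall v w, linear (fun a => Phi v a w : V)].

Lemma multilin_map phi : multilin phi -> multilin (fun s => phi (map nu s)).
Proof. by move=> mp u w c x y; rewrite !map_cat /= linearP mp. Qed.

Lemma letter_map s : letter (map nu s) = nu (letter s).
Proof. by case: s => [|a [|b s]]; rewrite /= ?linear0. Qed.

Lemma lettermul_map s : lettermul (map nu s) = nu (lettermul s).
Proof. by case: s => [|a [|b [|c s]]]; rewrite /= ?linear0 ?rmorphM. Qed.

Lemma contract_map phi s :
  contract phi (map nu s) = contract (fun t => phi (map nu t)) s.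
Proof.
rewrite /contract /insert cutsum_map; apply: eq_cutsum => u t _;
  rewrite cutsum_map.
by apply: eq_cutsum => x w _; rewrite lettermul_map map_cat /= size_map.
Qed.

(** Multiplying two neighbours commutes with rotating the cyclic word. According
    to where the cut falls, the product lies in [v], in [map nu u], or next to
    the distinguished letter; in the last case it comes from an outer term of
    [formdiff]. *)
Lemma formdiff_cycsum Phi s a :
  multilin3 Phi -> formdiff (cycsum Phi) s a = cycsum (contract3 Phi) s a.
Proof.
move=> [P1 P3 P2].
have P0 v w : Phi v 0 w = 0
  by have := P2 v w (-1) 0 0; rewrite scaler0 addr0 scaleN1r addNr.
rewrite /formdiff.
rewrite {3}/cycsum /contract3.
under [RHS]eq_cutsum do rewrite !scalerDr.
rewrite !cutsumD.
set L1 := cutsum _ s; set L3 := _ *: cutsum _ s.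
set R1 := cutsum _ s; set R2 := cutsum _ s; set R3 := cutsum _ s; set R4 :=
  cutsum _ s.
(* The first outer term: its letter is the first one of the cyclic word after
   the distinguished letter. *)
have -> : L1 = R3.
  rewrite /L1 /R3 /cycsum.
  pose G (u v t : seq R) : V := (-1) ^+ ((size (u ++ v)).+1 * size t) *:
     ((-1) ^+ size t *: Phi t (a * letter (map nu u)) (map nu v)).
  transitivity (cutsum (fun u t => cutsum (G u) t) s).
    apply: eq_cutsum => u t _; apply: eq_cutsum => v w _; rewrite /G letter_map.
    have [u1|/supported_letter ->] := eqVneq (size u) 1%N.
      by rewrite !scalerA -exprD; apply: sgnZ; rewrite size_cat u1; parity.
    by rewrite linear0 mulr0 P0 !scaler0.
  rewrite -cutsum_assoc; apply: eq_cutsum => u t _.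
  rewrite cutsum_map -!cutsumZ; apply: eq_cutsum => v w ->.
  by [].
(* The last outer term: its letter precedes the distinguished one. *)
have -> : L3 = R2.
  rewrite /L3 /R2 /cycsum -cutsumZ.
  pose G (u v t : seq R) : V := (-1) ^+ ((size u).+1 * size (v ++ t)) *:
     ((-1) ^+ size v *: Phi v (letter t * a) (map nu u)).
  transitivity (cutsum (fun u t => cutsum (fun u1 u2 => G u1 u2 t) u) s).
    apply: eq_cutsum => u t ->; rewrite -cutsumZ; apply: eq_cutsum => v w ->;
      rewrite /G.
    have [u1|/supported_letter ->] := eqVneq (size t) 1%N.
      by rewrite !scalerA -!exprD; apply: sgnZ; rewrite !size_cat u1; parity.
    by rewrite mul0r P0 !scaler0.
  rewrite cutsum_assoc; apply: eq_cutsum => u t _.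
  by rewrite -!cutsumZ; apply: eq_cutsum => v w ->.
suff -> : contract (cycsum Phi ^~ a) s = - R1 - R4 by zmod.
rewrite /contract /cycsum insert_cutsum cutsumD addrC -!cutsumN;
  congr (_ + _); apply: eq_cutsum => u v _.
  rewrite insert_sgn //; last exact: supported_lettermul.
  by rewrite -/(contract _ _); lin.
pose G t : V := (-1) ^+ size v *: Phi v a (map nu t).
rewrite (@eq_insert _ _ _ _ _ _ (fun t => (-1) ^+ (size v * size t) *: G t));
  last first.
  by move=> x; rewrite /G; sgn.
rewrite insert_sgn; [|move=> u' w' c x y; rewrite /G|exact: supported_lettermul].
  by rewrite insertZ contract_map -/(contract _ _); lin.
by rewrite (multilin_map (P3 _ _)) scalerDr !scalerA mulrC.
Qed.
Lemma multilin3_word (phi : seq R -> V) :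
  multilin phi -> multilin3 (fun v a w => phi (v ++ a :: w)).
Proof.
move=> mp; split=> [b w|v b|v w c x y]; last exact: mp.
  exact: multilin_catr.
have := @multilin_catl _ _ _ _ mp (v ++ [:: b]).
by move=> H u' w c x y; have := H u' w c x y; rewrite -!catA.
Qed.

End Cyclic.

Section CyclicWords.
Variables (k : fieldType) (R : falgType k) (nu : 'AEnd(R)) (V : lmodType k).
Variable eps : {linear R -> V}.
Hypothesis nak : forall a b, eps (a * b) = eps (b * nu a).
Implicit Types (f g h : seq R -> R) (s t u v w : seq R) (a b x y : R).
Implicit Types (phi : seq R -> V).

Definition equivariant f : Prop := forall s, f (map nu s) = nu (f s).

Definition rotsum phi := cycsum nu (fun v a w => phi (v ++ a :: w)).

Lemma eq_cycsum (P Q : seq R -> R -> seq R -> V) s a :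
  (forall u v, s = u ++ v -> P v a (map nu u) = Q v a (map nu u)) ->
  cycsum nu P s a = cycsum nu Q s a.
Proof. by move=> PQ; apply: eq_cutsum => u v /PQ ->. Qed.

Lemma formdiff_rotsum phi s a :
  multilin phi -> formdiff nu (rotsum phi) s a = rotsum (contract phi) s a.
Proof.
move=> mp; rewrite formdiff_cycsum; last exact: multilin3_word.
by apply: eq_cycsum => u v _; rewrite contract_cat_cons.
Qed.

Lemma multilin_eps f : multilin f -> multilin (eps \o f).
Proof. by move=> mf u w c x y /=; rewrite mf linearP. Qed.

Lemma eps_cutsum (F : seq R -> seq R -> R) s :
  eps (cutsum F s) = cutsum (fun u v => eps (F u v)) s.
Proof. exact: linear_sum. Qed.

Lemma insert_eps m g f s : eps (insert m g f s) = insert m g (eps \o f) s.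
Proof.
rewrite eps_cutsum; apply: eq_cutsum => u t _; rewrite eps_cutsum.
by apply: eq_cutsum => x w _; rewrite linearZ.
Qed.

Lemma conv_letter_word f v a w :
  conv letter f (v ++ a :: w) =
  cutsum (fun v1 v2 => letter v1 * f (v2 ++ a :: w)) v
  + (if v is [::] then a * f w else 0).
Proof.
rewrite /conv cutsum_cat_cons; congr (_ + _).
case: v => [|b v]; last by apply: cutsum_eq0 => x y _; case: v => [|? ?];
  rewrite mul0r.
rewrite cutsum_nill //= => b x y; exact: mul0r.
Qed.

Lemma conv_word_letter f v a w :
  conv f letter (v ++ a :: w) =
  cutsum (fun w1 w2 => f (v ++ a :: w1) * letter w2) w
  + (if w is [::] then f v * a else 0).
Proof.
rewrite /conv cutsum_cat_cons addrC; congr (_ + _); rewrite cutsum_nilr /=.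
  by case: w => // *; rewrite mulr0.
by move=> u b [|? x]; rewrite mulr0.
Qed.

(** A letter that multiplies [f] from the left in one rotation multiplies it from
    the right in the next one; the Nakayama relation and the invariance of [f]
    identify the two values. *)
Lemma rotsum_conv_letter f s a : equivariant f ->
  rotsum (eps \o conv letter f) s a = (-1) ^+ size s *:
    rotsum (eps \o conv f letter) s a.
Proof.
move=> ef; rewrite /rotsum /cycsum /=.
under eq_cutsum do rewrite conv_letter_word linearD scalerDr eps_cutsum.
under [in RHS]eq_cutsum do rewrite conv_word_letter linearD scalerDr eps_cutsum.
rewrite !cutsumD scalerDr; congr (_ + _).
  pose G (u v t : seq R) : V := (-1) ^+ ((size u).+1 * size (v ++ t)) *:
     eps (letter v * f (t ++ a :: map nu u)).
  transitivity (cutsum (fun u t => cutsum (G u) t) s).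
    by apply: eq_cutsum => u t _; rewrite -cutsumZ; apply: eq_cutsum => x y ->.
  rewrite -cutsum_assoc -cutsumZ; apply: eq_cutsum => u t ->;
    rewrite cutsum_map -!cutsumZ.
  apply: eq_cutsum => x y ->; rewrite /G letter_map -nak.
  have [u1|/supported_letter ->] := eqVneq (size y) 1%N.
    by rewrite !scalerA -!exprD; apply: sgnZ; rewrite !size_cat u1; parity.
  by rewrite mul0r linear0 !scaler0.
rewrite cutsum_nilr => [|u b v]; last by rewrite linear0 scaler0.
rewrite [in RHS]cutsum_nill => [|b u v]; last by rewrite linear0 scaler0.
by rewrite muln0 mul1n sgnZK scale1r ef -nak.
Qed.

(** The outer terms cancel in the sum over all rotations and contraction commutes
    with that sum. Read through the pairing, Delta anticommutes with the
    Hochschild differential. *)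
Lemma rotsum_hdiff f s a : multilin f -> equivariant f ->
  rotsum (eps \o hdiff f) s a = - formdiff nu (rotsum (eps \o f)) s a.
Proof.
move=> mf ef; rewrite formdiff_rotsum; last exact: multilin_eps.
have dE t : (eps \o hdiff f) t =
  (-1) *: contract (eps \o f) t + ((eps \o conv letter f) t + (-1) ^+ size t *:
    (eps \o conv f letter) t).
  rewrite /= /hdiff linearD linearB linearZ /= [eps (contract _ _)]insert_eps
    scaleN1r -/(contract _ _).
  zmod.
transitivity (- rotsum (contract (eps \o f)) s a + (rotsum (eps \o conv letter
  f) s a
   - (-1) ^+ size s *: rotsum (eps \o conv f letter) s a)); last first.
  by rewrite rotsum_conv_letter // subrr addr0.
rewrite /rotsum /cycsum -cutsumZ -cutsumN -cutsumB -cutsumD; apply: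
  eq_cutsum => u v ->.
rewrite dE; lin.
Qed.
End CyclicWords.

(** * Homotopies *)

Section InsertionExtra.
Variables (k : comNzRingType) (A : algType k) (V : lmodType k).
Implicit Types (l m n : nat) (g h : seq A -> A) (s t u v w : seq A).

Lemma insert_cons0 m g (F : seq A -> V) s :
  (forall a u, F (a :: u) = 0) -> insert m g F s = 0.
Proof.
move=> F0; apply: cutsum_eq0 => u t _; apply: cutsum_eq0 => x w _.
by case: u => [|a u]; rewrite F0 scaler0.
Qed.

Lemma insert_cutsum_exchange m g (F : seq A -> seq A -> seq A -> V) s t :
  insert m g (fun y => cutsum (F y) t) s =
  cutsum (fun u v => insert m g (fun y => F y u v) s) t.
Proof.
rewrite /insert [RHS]cutsum_exchange; apply: eq_cutsum => u v _.
rewrite [RHS]cutsum_exchange; apply: eq_cutsum => x w _.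
by rewrite cutsumZ.
Qed.

Lemma insert_exchange m g l h (F : seq A -> seq A -> V) s t :
  insert m g (fun y => insert l h (F y) t) s =
  insert l h (fun z => insert m g (F^~ z) s) t.
Proof.
rewrite {2}/insert insert_cutsum_exchange; apply: eq_cutsum => u v _.
rewrite insert_cutsum_exchange; apply: eq_cutsum => x w _.
by rewrite insertZ.
Qed.

Lemma multilin_cutsum_param (F : seq A -> seq A -> seq A -> V) t :
  (forall v w, multilin (fun y => F y v w)) -> multilin (fun y => cutsum (F y) t).
Proof.
move=> mF u w c x y; rewrite -cutsumZ -cutsumD.
by apply: eq_cutsum => w1 w2 _; exact: mF.
Qed.

Lemma insertB m g (F G : seq A -> V) s :
  insert m g (fun t => F t - G t) s = insert m g F s - insert m g G s.
Proof. by rewrite insertD insertN. Qed.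

End InsertionExtra.

Section Homotopies.
Variables (k : fieldType) (R : falgType k) (nu : 'AEnd(R)) (V : lmodType k).
Variable eps : {linear R -> V}.
Hypothesis nak : forall a b, eps (a * b) = eps (b * nu a).
Implicit Types (f g h : seq R -> R) (s t u v w : seq R) (a b : R).

Definition pairing h s a : V := eps (h s * a).

(** The Nakayama relation moves the left factor of the first outer term to the
    right. *)
Lemma pairing_hdiff h s a : pairing (hdiff h) s a = formdiff nu (pairing h) s a.
Proof.
rewrite /pairing /hdiff /formdiff !mulrDl linearD linearD mulNr linearN
  -scalerAl linearZ /=.
congr (_ - _ + _ *: _).
- rewrite /conv cutsum_mulr eps_cutsum; apply: eq_cutsum => u v _.
  by rewrite -mulrA nak -mulrA.
- by rewrite -[contract h s * a]insert_mulr insert_eps.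
- by rewrite /conv cutsum_mulr eps_cutsum; apply: eq_cutsum => u v _;
  rewrite mulrA.
Qed.

(** The product of the unit with the letter after it cancels the first outer
    term. *)
Lemma hdiff_cons1 g w : multilin g -> w != [::] ->
  hdiff g (1 :: w) =
  contract (fun t => g (1 :: t)) w - (-1) ^+ size w *: conv (fun t =>
    g (1 :: t)) letter w.
Proof.
move=> mlg; case: w => // b w _; rewrite /hdiff.
have -> : conv letter g ([:: 1, b & w] : seq R) = g (b :: w).
  by rewrite /conv cutsum_cons mul0r add0r cutsum_nill ?mul1r // => *;
    rewrite mul0r.
have -> : conv g letter [:: 1, b & w] = conv (fun t =>
  g (1 :: t)) letter (b :: w).
  by rewrite /conv cutsum_cons mulr0 add0r.
have := @contract_cat_cons _ _ _ _ [::] 1 (b :: w) mlg; rewrite /= => ->.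
have -> : contract (fun t => g (t ++ [:: 1, b & w])) [::] = 0.
  by rewrite /contract /insert !cutsum_nil /= (multilin0 mlg [::]) ?scaler0.
rewrite cutsum_nil /= mul0r (multilin0 mlg [::]) scaler0 expr0 !scale1r !add0r.
have -> : cutsum (fun w1 w2 => g (1 * letter w1 :: w2)) (b :: w) = g (b :: w).
  rewrite cutsum_cons mulr0 (multilin0 mlg [::]) add0r cutsum_nill /= ?mul1r //
    => *.
  exact: (multilin0 mlg [::]).
by lin.
Qed.

(** Both sides run over the rotations of one cyclic word, because nu fixes the
    unit. *)
Lemma rotsum_shift (phi : seq R -> V) t x :
  (forall s, phi (map nu s) = phi s) ->
  rotsum nu phi (1 :: t) x = (-1) ^+ (size t).+1 *: rotsum nu phi (t ++ [:: x]) 1.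
Proof.
move=> ephi; rewrite /rotsum /cycsum cutsum_cons cutsum_cat_cons addrC scalerDr
  cutsum_nil.
congr (_ + _).
  rewrite -cutsumZ; apply: eq_cutsum => u v -> /=.
  by rewrite rmorph1 -catA; sgn.
rewrite /= muln0 mul1n scale1r -[phi (1 :: t ++ _)]ephi /=.
by rewrite rmorph1.
Qed.

(** The homotopy for the square of Delta, used with [g] the value of Delta at a
    cocycle [f]. By [hdiff_cons1] the contractions of g(1, ..) reduce to the
    product of g(1, ..) with the last letter. Written in terms of [f], this
    product and the value of [g] on the word itself are rotations of each other,
    by [rotsum_shift]. *)
Lemma formdiff_rotsum_cons1 f g s a :
  equivariant nu f -> multilin g -> pairing g =2 rotsum nu (eps \o f) ->
    hdiff g =1 (fun _ => 0) ->
  formdiff nu (rotsum nu (fun w => eps (g (1 :: w)))) s a =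
    rotsum nu (eps \o g) s a.
Proof.
move=> ef mlg gf dg.
have multilin1 : multilin (fun w => g (1 :: w)) by exact:
  (@multilin_catl _ _ _ _ mlg [:: 1]).
rewrite formdiff_rotsum; last exact: (multilin_eps eps multilin1).
apply: eq_cycsum => u v _; rewrite -[LHS](insert_eps eps) -/(contract _ _).
have : v ++ a :: map nu u != [::] by case: v.
case/lastP: (v ++ _) => // t x tx0.
have /esym/eqP := hdiff_cons1 mlg tx0; rewrite dg subr_eq0 => /eqP ->.
rewrite -cats1 conv_word_letter cutsum_nil mulr0 add0r linearZ /=.
rewrite -[eps (g (1 :: t) * x)]/(pairing g (1 :: t) x) gf rotsum_shift => [|r /=].
  by rewrite size_cat addn1 sgnZK -gf /pairing mulr1.
by rewrite ef -[nu _]mul1r -nak mulr1.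
Qed.

Section InsertionHomotopy.
Variables (m n : nat) (f g : seq R -> R).
Hypotheses (mf : multilin f) (sf : supported n f).
Hypotheses (mlg : multilin g) (sg : supported m g).

(** [g] is inserted before the distinguished letter only. Its cyclic sum is the
    homotopy that relates f o g to a part of Delta at the cup product. *)
Definition insert_form v a w : V := insert m g (fun y => eps (f (y ++ a :: w))) v.

(** Up to sign, the part of Delta at the cup product in which the distinguished
    letter is an argument of [f]. *)
Definition cut_form f g s a : V := cutsum (fun u t => cutsum (fun v1 v2 =>
  (-1) ^+ ((size u).+1 * size t) *: eps (g v1 * f (v2 ++ a :: map nu u))) t) s.

Lemma multilin_word a w : multilin (fun y => eps (f (y ++ a :: w))).
Proof. exact: (@multilin_catr _ _ _ _ (multilin_eps eps mf) (a :: w)). Qed.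

Lemma multilin3_insert_form : multilin3 insert_form.
Proof.
split=> [a w|v a u w c x y|v w c x y].
- exact: multilin_insert (multilin_word a w) mlg.
- rewrite -insert_lin; apply: eq_insert => t.
  have := @multilin_catl _ _ _ _ (multilin_eps eps mf) (t ++ [:: a]) u w c x y.
  by rewrite -!catA.
- by rewrite -insert_lin; apply: eq_insert => t; rewrite mf linearP.
Qed.

Hypothesis dg : hdiff g =1 (fun _ => 0).

(** As [g] is a cocycle, contraction commutes with its insertion. The correction
    term is due to the product of an output of [g] with [a] standing next to it:
    it is a contraction of the word seen by [f], but [a] can never be an
    argument of [g]. *)
Lemma contract3_insert_form v a w :
  contract3 insert_form v a w = (-1) ^+ m.+1 *:
   (insert m g (fun y => contract (eps \o f) (y ++ a :: w)) v
    - cutsum (fun u t => (-1) ^+ (m * size u) *: eps (f (u ++ (g t * a) :: w)))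
      v).
Proof.
have contractE y : contract (eps \o f) (y ++ a :: w) =
    contract (fun t => eps (f (t ++ a :: w))) y
    + cutsum (fun y1 y2 => (-1) ^+ size y1 *:
      eps (f (y1 ++ (letter y2 * a) :: w))) y
    + (-1) ^+ (1 * size y) *: cutsum (fun w1 w2 =>
      eps (f (y ++ (a * letter w1) :: w2))) w
    - (-1) ^+ (1 * size y) *: contract (fun t => eps (f (y ++ a :: t))) w.
  by rewrite contract_cat_cons ?mul1n //; exact: multilin_eps.
rewrite (eq_insert m g contractE) insertB 2!insertD.
rewrite (insert_sgn 1 v _ sg); last first.
  apply: multilin_cutsum_param => w1 w2; exact: multilin_word.
rewrite (insert_sgn 1 v _ sg); last first.
  move=> u t c x y; rewrite -insert_lin; apply: eq_insert => r; exact: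
    multilin_word.
rewrite insert_cutsum_exchange.
have -> : insert m g (fun t => contract (fun r => eps (f (t ++ a :: r))) w) v =
          contract (fun r => insert_form v a r) w by exact: insert_exchange.
have -> : insert m g (cutsum (fun y1 y2 =>
            (-1) ^+ size y1 *: eps (f (y1 ++ letter y2 * a :: w)))) v =
  (-1) ^+ m.+1 *: cutsum (fun u t => (-1) ^+ size u *:
    insert_form u (letter t * a) w) v
  + cutsum (fun u t => (-1) ^+ (m * size u) *: eps (f (u ++ (g t * a) :: w))) v.
  rewrite insert_cutsum cutsumD -cutsumZ; congr (_ + _); apply:
    eq_cutsum => u t _.
    have -> : insert m g (fun y => (-1) ^+ size y *:
      eps (f (y ++ letter t * a :: w))) u =
      insert m g (fun y => (-1) ^+ (1 * size y) *:
        eps (f (y ++ letter t * a :: w))) u.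
      by apply: eq_insert => r; rewrite mul1n.
    rewrite (insert_sgn 1 u (multilin_word _ _) sg) -/(insert_form _ _ _); lin.
  rewrite (insert_at_letter _ _ (L := fun b => (-1) ^+ size u *:
    eps (f (u ++ b * a :: w)))).
    lin.
  by rewrite mul0r multilin0 // linear0 scaler0.
rewrite /contract3 /insert_form [contract (insert m g _) v]contract_insert //;
  last exact: multilin_word.
have -> : insert m.+1 (hdiff g) (fun y => eps (f (y ++ a :: w))) v = 0.
  apply: cutsum_eq0 => u t _; apply: cutsum_eq0 => x y _.
  by rewrite dg (multilin0 (multilin_word a w)) scaler0.
lin.
Qed.

Hypothesis df : hdiff f =1 (fun _ => 0).

Definition insert_word a w v : R := insert m g (fun y => f (y ++ a :: w)) v.

(** As [f] is a cocycle, its contractions amount to its outer terms. The factor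
    on the left is a letter or an output of [g]; the factor on the right is a
    letter, or [a] if nothing follows it. *)
Lemma insert_contract_word v a w :
  insert m g (fun y => contract (eps \o f) (y ++ a :: w)) v =
  cutsum (fun v1 v2 => eps (g v1 * f (v2 ++ a :: w))
        + (-1) ^+ (m.+1 * size v1) *: eps (letter v1 * insert_word a w v2)) v
  + (-1) ^+ (size v + m + size w) *:
      (cutsum (fun w1 w2 => eps (insert_word a w1 v * letter w2)) w
       + (if w is [::] then eps (insert m g f v * a) else 0)).
Proof.
pose T y : V := cutsum (fun w1 w2 => eps (f (y ++ a :: w1) * letter w2)) w
  + (if w is [::] then eps (f y * a) else 0).
have contractE y : contract (eps \o f) (y ++ a :: w) =
    cutsum (fun y1 y2 => eps (letter y1 * f (y2 ++ a :: w))) y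
    + (if y is [::] then eps (a * f w) else 0)
    + (-1) ^+ (1 * size y) *: ((-1) ^+ (size w).+1 *: T y).
  rewrite -[LHS](insert_eps eps) -/(contract _ _).
  have := df (y ++ a :: w); rewrite /hdiff conv_letter_word conv_word_letter =>
    /eqP.
  rewrite addrAC subr_eq0 => /eqP <-; rewrite (linearD eps) linearZ !(linearD
    eps).
  rewrite !eps_cutsum scalerA -exprD; congr (_ + _ + _).
    by case: (y) => //; rewrite linear0.
  congr (_ *: (_ + _)); last by case: (w) => //; rewrite linear0.
  by apply: sgn_eq; parity.
rewrite (eq_insert m g contractE) !insertD; congr (_ + _).
  rewrite [X in _ + X]insert_cons0 // addr0 insert_cutsum; apply:
    eq_cutsum => v1 v2 _.
  congr (_ + _ *: _).
    by rewrite (insert_at_letter _ _ (L := fun b =>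
      eps (b * f (v2 ++ a :: w)))) // mul0r linear0.
  by rewrite -insert_mull insert_eps.
rewrite (insert_sgn 1 v _ sg); last first.
  have mT : multilin T.
    move=> u t c x y; rewrite /T.
    have := @multilin_cutsum_param _ _ _ (fun y w1 w2 =>
      eps (f (y ++ a :: w1) * letter w2)) w.
    move=> H; rewrite H; last first.
      move=> v' w' u' t' c' x' y'.
      by rewrite -!catA /= mf mulrDl -scalerAl linearP.
    rewrite scalerDr [RHS]addrACA; congr (_ + _).
    by case: (w) => *; rewrite ?scaler0 ?addr0 // mf mulrDl -scalerAl linearP.
  by move=> u t c x y; rewrite mT scalerDr !scalerA mulrC.
rewrite insertZ scalerA -exprD; congr (_ *: _).
  by apply: sgn_eq; parity.
rewrite insertD insert_cutsum_exchange; congr (_ + _).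
  by apply: eq_cutsum => w1 w2 _; rewrite /insert_word -insert_mulr insert_eps.
by case: (w) => *; rewrite ?insert0 // -insert_mulr insert_eps.
Qed.

(** The terms in which an ordinary letter multiplies [f] from outside cancel
    between consecutive rotations. What remains are the terms in which an output
    of [g], or the distinguished letter, has left [f]. *)
Lemma cycsum_insert_contract s a :
  cycsum nu (fun v a w => insert m g (fun y =>
    contract (eps \o f) (y ++ a :: w)) v) s a =
  cut_form f g s a + (-1) ^+ m *: eps (insert m g f s * a).
Proof.
rewrite /cycsum; under eq_cutsum do rewrite insert_contract_word cutsumD
  !scalerDr.
rewrite !cutsumD.
set X1 := cutsum _ s; set X2 := cutsum _ s; set X3 := cutsum _ s; set X4 :=
  cutsum _ s.
have -> : X1 = cut_form f g s a.
  by apply: eq_cutsum => u v _; rewrite -cutsumZ.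
have -> : X4 = (-1) ^+ m *: eps (insert m g f s * a).
  rewrite /X4 cutsum_nill => [|b u v] /=; last by rewrite !scaler0.
  by rewrite mul1n scalerA -exprD; sgn.
(* [X2] and [X3] collect the ordinary letters to the left and to the right of
   [f], in consecutive rotations. *)
suff -> : X2 = - X3 by zmod.
rewrite /X2 /X3 -cutsumN.
pose G (u v t : seq R) : V := (-1) ^+ ((size u).+1 * size (v ++ t)) *:
     ((-1) ^+ (m.+1 * size v) *: eps (letter v * insert_word a (map nu u) t)).
transitivity (cutsum (fun u t => cutsum (G u) t) s).
  by apply: eq_cutsum => u t _; rewrite -cutsumZ; apply: eq_cutsum => p q ->.
rewrite -cutsum_assoc; apply: eq_cutsum => u t _;
  rewrite cutsum_map -!cutsumZ -cutsumN.
apply: eq_cutsum => p q ->; rewrite /G letter_map -nak.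
have [u1|/supported_letter ->] := eqVneq (size q) 1%N.
  by rewrite !size_map !size_cat u1; lin.
by rewrite mul0r linear0 !scaler0 oppr0.
Qed.

(** The cup product with [D], the value of Delta at [f], is the correction term of
    [contract3_insert_form]: there the output of [g] times [a] is one letter of
    a rotated word. *)
Lemma formdiff_cycsum_insert_form (D : seq R -> R) s a :
  pairing D =2 rotsum nu (eps \o f) ->
  formdiff nu (cycsum nu insert_form) s a = (-1) ^+ m.+1 *:
   (cut_form f g s a + (-1) ^+ m *: pairing (insert m g f) s a
    - (-1) ^+ (m * n) *: pairing (conv D g) s a).
Proof.
move=> DE; rewrite formdiff_cycsum; last exact: multilin3_insert_form.
rewrite -[pairing (insert _ _ _) s a]/(eps (insert m g f s * a))
  -cycsum_insert_contract.
rewrite /cycsum.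
have -> : pairing (conv D g) s a = cutsum (fun u t => cutsum (fun q p =>
   (-1) ^+ ((size u).+1 * size q) *: eps (f (q ++ (g p * a) :: map nu u))) t) s.
  rewrite /pairing cutsum_mulr eps_cutsum -cutsum_assoc; apply:
    eq_cutsum => u v _.
  by rewrite -mulrA -[eps _]/(pairing D u (g v * a)) DE.
rewrite -cutsumZ -cutsumB -cutsumZ; apply: eq_cutsum => u v _.
rewrite contract3_insert_form scalerA [_ * (-1) ^+ _]mulrC -scalerA scalerBr;
  congr (_ *: (_ - _)).
rewrite -!cutsumZ; apply: eq_cutsum => p q ->.
have [qm|/sg ->] := eqVneq (size q) m; last first.
  rewrite mul0r (multilin0 mf) linear0 !scaler0 //.
have [wn|/sf ->] := eqVneq (size (p ++ g q * a :: map nu u)) n; last first.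
  by rewrite linear0 !scaler0.
by rewrite -wn -qm; sgn.
Qed.

End InsertionHomotopy.

(** The distinguished letter is an argument of [g] or of [f]; in the second case
    the Nakayama relation moves the value of [g] to the front. *)
Lemma rotsum_conv m n f g s a : supported n f -> supported m g ->
  equivariant nu f -> equivariant nu g ->
  rotsum nu (eps \o conv f g) s a = cut_form g f s a + (-1) ^+ (m * n) *:
    cut_form f g s a.
Proof.
move=> sf sg ef eg; rewrite /rotsum /cycsum /=.
under eq_cutsum do rewrite /conv cutsum_cat_cons linearD scalerDr !eps_cutsum.
rewrite cutsumD; congr (_ + _).
  by apply: eq_cutsum => u v _; rewrite -cutsumZ.
pose G (u v t : seq R) : V := (-1) ^+ ((size (u ++ v)).+1 * size t) *:
     eps (f (t ++ a :: map nu u) * g (map nu v)).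
transitivity (cutsum (fun u t => cutsum (fun u1 u2 => G u1 u2 t) u) s).
  by apply: eq_cutsum => u t _; rewrite cutsum_map -cutsumZ;
    apply: eq_cutsum => p q ->.
rewrite cutsum_assoc -cutsumZ; apply: eq_cutsum => u t _; rewrite -cutsumZ.
apply: eq_cutsum => p q ->; rewrite /G eg -nak.
have [<-|/sg ->] := eqVneq (size p) m; last by rewrite mul0r linear0 !scaler0.
have [<-|/sf ->] := eqVneq (size (q ++ a :: map nu u)) n; last first.
  by rewrite mulr0 linear0 !scaler0.
by sgn.
Qed.

End Homotopies.

(** * Cochains as functions on lists *)

Section Extension.
Variables (k : fieldType) (R : falgType k).
Local Notation cochain n := (n.-tuple R -> R).
Implicit Types (s t u v w : seq R).

(** Extension by zero. Functions on lists carry no degree in their type, so no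
    casts between equal degrees are needed. *)
Definition ext n (f : cochain n) s : R := if size s == n then ev f s else 0.

Lemma ev_tuple n (f : cochain n) (a : n.-tuple R) : ev f a = f a.
Proof.
by congr f; apply: eq_from_tnth => i; rewrite tnth_mktuple (tnth_nth 0).
Qed.

Lemma extE n (f : cochain n) s : size s = n -> ext f s = ev f s.
Proof. by move=> sn; rewrite /ext sn eqxx. Qed.

Lemma ext_tuple n (f : cochain n) (a : n.-tuple R) : ext f a = f a.
Proof. by rewrite extE ?size_tuple // ev_tuple. Qed.

Lemma supported_ext n (f : cochain n) : supported n (ext f).
Proof. by move=> s /negbTE sn; rewrite /ext sn. Qed.

Lemma ext_lin n c (f g : cochain n) s :
  ext (c *: f + g) s = c *: ext f s + ext g s.
Proof. by rewrite /ext; case: eqP => // _; rewrite scaler0 addr0. Qed.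

Lemma ext0 n s : ext (0 : cochain n) s = 0.
Proof. by rewrite /ext; case: eqP. Qed.

Lemma extB n (f g : cochain n) s : ext (f - g) s = ext f s - ext g s.
Proof. by rewrite addrC -scaleN1r ext_lin scaleN1r addrC. Qed.

Lemma ext_inj n (f g : cochain n) : ext f =1 ext g -> f = g.
Proof. by move=> fg; apply/funext => a; rewrite -!ext_tuple fg. Qed.

Lemma ext_eq n (f : cochain n) (F : seq R -> R) : supported n F ->
  (forall a : n.-tuple R, f a = F a) -> ext f =1 F.
Proof.
move=> sF fF s; have [sn|sn] := eqVneq (size s) n; last first.
  by rewrite supported_ext // sF.
by rewrite -[s]/(tval (Tuple (introT eqP sn))) ext_tuple fF.
Qed.

Lemma multilin_ext n (f : cochain n) : multilinear f <-> multilin (ext f).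
Proof.
split=> [mf u w c x y|mf s t c x y st].
  rewrite /ext !size_cat /=; case: eqP => [uw|_]; last by rewrite scaler0 addr0.
  by apply: mf; rewrite -uw addnS.
by rewrite -!extE ?mf // size_cat /= addnS.
Qed.

Lemma cutsum_at (V : zmodType) m (F : seq R -> seq R -> V) s :
  (forall u v, s = u ++ v -> size u != m -> F u v = 0) ->
  cutsum F s = if (m <= size s)%N then F (take m s) (drop m s) else 0.
Proof.
move=> F0; have [ms|ms] := leqP m (size s); last first.
  by apply: cutsum_eq0 => u v sE; apply: F0 => //; move: ms;
    rewrite sE size_cat; lia.
rewrite /cutsum (bigD1 (Ordinal (ms : m < (size s).+1)%N)) //= big1 ?addr0 //
  => i im.
apply: F0; first by rewrite cat_take_drop.
by rewrite size_take_min (minn_idPl _) // -ltnS.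
Qed.

Lemma insertE (V : lmodType k) m g (F : seq R -> V) s :
  multilin F -> supported m g ->
  insert m g F s = \sum_(i < (size s).+1 - m)
    (-1) ^+ (m.+1 * i) *: F (take i s ++ g (take m (drop i s)) :: drop (i + m) s).
Proof.
move=> mF sg; rewrite /insert {1}/cutsum.
pose T i := (-1) ^+ (m.+1 * i) *: F (take i s ++ g (take m (drop i s)) :: drop
  (i + m) s).
transitivity (\sum_(i < (size s).+1) if (i < (size s).+1 - m)%N then T i else 0).
  apply: eq_bigr => i _; rewrite (cutsum_at (m := m)) => [|u v _ /sg ->];
    last first.
    by rewrite multilin0 // scaler0.
  have iS : (i <= size s)%N by rewrite -ltnS.
  rewrite size_drop size_takel // drop_drop [(m + i)%N]addnC -/(T i).
  by rewrite ltn_subRL addnC ltnS leq_subRL // addnC.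
by rewrite -big_mkcond /= (big_ord_widen (size s).+1 T) ?leq_subr.
Qed.

Lemma ext_hcup n m (f : cochain n) (g : cochain m) :
  ext (hcup f g) =1 conv (ext f) (ext g).
Proof.
apply: ext_eq => [|a]; first exact: supported_conv (supported_ext f)
  (supported_ext g).
rewrite /conv (cutsum_at (m := n)) => [|u v _ /supported_ext ->];
  last by rewrite mul0r.
by rewrite size_tuple leq_addr !extE // ?size_takel ?size_drop ?size_tuple
  ?leq_addr // addKn.
Qed.

Lemma insert_ext n m (f : cochain n) (g : cochain m) s : multilinear f ->
  size s = (n + m).-1 -> insert m (ext g) (ext f) s = hcirc f g s.
Proof.
move=> /multilin_ext mf sE.
have [nm0|nm0] := eqVneq (n + m)%N 0%N.
  rewrite (supported_insert mf (supported_ext f) (supported_ext g)) ?nm0 //.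
  by rewrite /hcirc big1 // => i _; have := ltn_ord i; lia.
have sE' : (size s).+1 = (n + m)%N by rewrite sE prednK // lt0n.
rewrite insertE ?sE' ?addnK //; last exact: supported_ext.
apply: eq_bigr => i _; have := ltn_ord i => ilt.
rewrite !extE //.
all: rewrite ?size_cat /= ?size_takel ?size_drop; lia.
Qed.

Lemma supported_hbracket_seq n m (f : cochain n) (g : cochain m) :
  multilinear f ->
  supported (n + m).-1 (insert m (ext g) (ext f)).
Proof.
move=> /multilin_ext mf s sE; apply: supported_insert (supported_ext f)
  (supported_ext g) _ => //.
by apply: contra_neq sE; case: (n + m)%N => // ? [].
Qed.

Lemma ext_hbracket n m (f : cochain n) (g : cochain m) :
  multilinear f -> multilinear g -> ext (hbracket f g) =1
  fun s => insert m (ext g) (ext f) s - (-1) ^+ (n.+1 * m.+1) *: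
    insert n (ext f) (ext g) s.
Proof.
move=> mf contract; apply: ext_eq => [s sE|a].
  rewrite supported_hbracket_seq // supported_hbracket_seq ?scaler0 ?subr0 //.
  by rewrite addnC.
by rewrite /hbracket !insert_ext // ?size_tuple // addnC.
Qed.

Lemma supported_hdiff n (f : seq R -> R) :
  multilin f -> supported n f -> supported n.+1 (hdiff f).
Proof.
move=> mf sf s sn; rewrite /hdiff.
rewrite (supported_conv supported_letter sf) ?add1n // (supported_conv sf
  supported_letter) ?addn1 //.
by rewrite /contract (supported_insert mf sf supported_lettermul) ?scaler0
  ?subrr ?addr0 // addn2 eqSS.
Qed.

(** Only the values of [F] on lists of length n enter, so [F] may be a primitive
    that is nonzero in other lengths too. *)
Lemma hdeltaE n (f : cochain n) (F : seq R -> R) : multilin F ->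
  (forall s, size s = n -> F s = ev f s) ->
  forall a : n.+1.-tuple R, hdelta f a = hdiff F a.
Proof.
move=> mF Ff a; have sa := size_tuple a.
rewrite /hdelta /hdiff sa; congr (_ + _ + _ *: _).
- rewrite /conv (cutsum_at (m := 1)) => [|u v _ /supported_letter ->];
  last by rewrite mul0r.
  rewrite sa /= drop1 Ff ?size_behead ?sa //.
  by case: (tval a) sa => // x s _; rewrite /= take0.
- rewrite /contract insertE //; last exact: supported_lettermul.
  rewrite sa subn2 /= -sumrN; apply: eq_bigr => i _; have ilt := ltn_ord i.
  rewrite Ff; last first.
    by rewrite size_cat /= size_takel ?size_drop ?sa; lia.
  have -> : lettermul (take 2 (drop i a)) = a`_i * a`_i.+1.
    have i1 : (i < size a)%N by rewrite sa; lia.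
    have i2 : (i.+1 < size a)%N by rewrite sa; lia.
    by rewrite (drop_nth 0 i1) (drop_nth 0 i2) /= take0.
  by rewrite addn2; lin.
- rewrite /conv (cutsum_at (m := n)) => [|u v aE un]; last first.
    rewrite supported_letter ?mulr0 //; apply: contra_neq un => v1.
    by move: sa; rewrite aE size_cat v1 addn1 => -[].
  rewrite sa leqnSn Ff ?size_takel ?sa //; congr (_ * _).
  by rewrite (drop_nth 0) ?sa // drop_oversize ?sa.
Qed.

Lemma ext_hdelta n (f : cochain n) :
  multilinear f -> ext (hdelta f) =1 hdiff (ext f).
Proof.
move=> /multilin_ext mf; apply: ext_eq => [|a].
  exact: supported_hdiff mf (supported_ext f).
by apply: hdeltaE => // s; exact: extE.
Qed.

End Extension.

(** * From functionals to cochains and coboundaries *)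

Section Functionals.
Variables (k : fieldType) (R : falgType k) (nu : 'AEnd(R)) (V : lmodType k).
Implicit Types (s t u v w : seq R) (psi : seq R -> R -> V).

(** The functionals <h s, a> of nu-invariant multilinear h. *)
Definition invariant_form psi : Prop :=
  [/\ forall a, multilin (psi^~ a), forall s, linear (psi s)
    & forall s a, psi (map nu s) (nu a) = psi s a].

Lemma invariant_form_lin psi psi' c :
  invariant_form psi -> invariant_form psi' ->
  invariant_form (fun s a => c *: psi s a + psi' s a).
Proof.
move=> [m1 l1 e1] [m2 l2 e2]; split=> [a u w d x y|s d x y|s a].
- rewrite m1 m2 !scalerDr addrACA; congr (_ + _).
  by rewrite !scalerA mulrC.
- rewrite l1 l2 !scalerDr addrACA; congr (_ + _).
  by rewrite !scalerA mulrC.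
- by rewrite e1 e2.
Qed.

Lemma formdiff_lin psi psi' c s a :
  formdiff nu (fun s a => c *: psi s a + psi' s a) s a =
  c *: formdiff nu psi s a + formdiff nu psi' s a.
Proof.
rewrite /formdiff /contract insert_lin !cutsumD !cutsumZ.
rewrite !scalerDr !scalerN !scalerA [c * _]mulrC; zmod.
Qed.

Lemma eq_formdiff psi psi' : psi =2 psi' -> formdiff nu psi =2 formdiff nu psi'.
Proof.
move=> pp s a; rewrite /formdiff; congr (_ - _ + _ *: _).
- by apply: eq_cutsum => u v _; rewrite pp.
- by apply: eq_insert => t; rewrite pp.
- by apply: eq_cutsum => u v _; rewrite pp.
Qed.

Lemma multilin_size (c : nat -> k) (F : seq R -> V) :
  multilin F -> multilin (fun s => c (size s) *: F s).
Proof.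
move=> mF u w d x y; rewrite mF !size_cat /= scalerDr !scalerA.
by rewrite mulrC.
Qed.

Lemma invariant_cycsum (Phi : seq R -> R -> seq R -> V) :
  multilin3 Phi -> (forall v a w, Phi (map nu v) (nu a) (map nu w) = Phi v a w) ->
  invariant_form (cycsum nu Phi).
Proof.
move=> [P1 P3 P2] Pe; split=> [a|s c x y|s a].
- apply: multilin_cutsum => [v|u].
    apply: (multilin_size (fun i => (-1) ^+ (i.+1 * size v))).
    exact: multilin_map.
  exact: (multilin_size (fun i => (-1) ^+ ((size u).+1 * i))).
- rewrite /cycsum -cutsumZ -cutsumD; apply: eq_cutsum => u v _.
  by rewrite P2 scalerDr !scalerA mulrC.
- by rewrite /cycsum cutsum_map; apply: eq_cutsum => u v _; rewrite Pe !size_map.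
Qed.

Lemma invariant_rotsum (phi : seq R -> V) :
  multilin phi -> (forall s, phi (map nu s) = phi s) ->
    invariant_form (rotsum nu phi).
Proof.
move=> mp ep; apply: invariant_cycsum; first exact: multilin3_word.
by move=> v a w; rewrite -[RHS]ep map_cat.
Qed.

Variable eps : {linear R -> V}.
Hypothesis nak : forall a b, eps (a * b) = eps (b * nu a).

Lemma eps_nu a : eps (nu a) = eps a.
Proof. by rewrite -[nu a]mul1r -nak mulr1. Qed.

Lemma invariant_pairing h :
  multilin h -> equivariant nu h -> invariant_form (pairing eps h).
Proof.
move=> mh eh; split=> [a u w c x y|s c x y|s a]; rewrite /pairing.
- by rewrite mh mulrDl -scalerAl linearP.
- by rewrite mulrDr -scalerAr linearP.
- by rewrite eh -rmorphM eps_nu.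
Qed.

Lemma invariant_insert_form m f g :
  multilin f -> equivariant nu f -> multilin g -> equivariant nu g ->
  invariant_form (cycsum nu (insert_form eps m f g)).
Proof.
move=> mf ef mlg eg; apply: invariant_cycsum; first exact: multilin3_insert_form.
move=> v a w; rewrite /insert_form /insert cutsum_map; apply: eq_cutsum => u t _.
rewrite cutsum_map; apply: eq_cutsum => x y _; rewrite size_map eg.
have -> : (map nu u ++ nu (g x) :: map nu y) ++ nu a :: map nu w =
          map nu ((u ++ g x :: y) ++ a :: w) by rewrite !map_cat.
by rewrite ef eps_nu.
Qed.

End Functionals.

Section Coboundaries.
Variables (k : fieldType) (R : falgType k) (nu : 'AEnd(R)).
Local Notation cochain n := (n.-tuple R -> R).
Implicit Types (s t u v w : seq R) (F G : seq R -> R).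

(** The degree d - 1 of the primitive is not mentioned, which covers d = 0: there
    the condition forces [F] to vanish on the empty list. *)
Definition cobounds d F : Prop :=
  exists G, [/\ multilin G, equivariant nu G & forall s, size s = d -> F s =
    hdiff G s].

Lemma hdiff_lin c F G s :
  hdiff (fun t => c *: F t + G t) s = c *: hdiff F s + hdiff G s.
Proof.
rewrite /hdiff /contract conv_linl conv_linr insert_lin !scalerDr !scalerN
  !scalerA [c * _]mulrC.
zmod.
Qed.

Lemma eq_cobounds d F G :
  (forall s, size s = d -> F s = G s) -> cobounds d F -> cobounds d G.
Proof.
move=> FG [F' [mF eF FE]]; exists F'; split=> // s sd.
by rewrite -FG // FE.
Qed.

Hypothesis bij_nu : bijective nu.

Lemma nu_invK : cancel (nu^-1)%VF nu.
Proof. by apply: lker0_lfunVK; apply/lker0P; exact: bij_inj. Qed.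

Lemma nuK_inv : cancel nu (nu^-1)%VF.
Proof. by apply: lker0_lfunK; apply/lker0P; exact: bij_inj. Qed.

(** The invariance f^nu = f says that [f] commutes with nu. *)
Lemma nu_cochainP n (f : cochain n) :
  nu_cochain nu f <-> multilin (ext f) /\ equivariant nu (ext f).
Proof.
split=> [[/multilin_ext mf ff]|[/multilin_ext mf ef]].
  split=> // s; have [sn|sn] := eqVneq (size s) n; last first.
    by rewrite !supported_ext ?size_map ?linear0.
  rewrite -[s]/(tval (Tuple (introT eqP sn))).
  rewrite -[map nu _]/(tval (map_tuple nu (Tuple (introT eqP sn)))) !ext_tuple.
  by rewrite -[in RHS]ff /htwist nu_invK.
split=> //; apply/funext => a; rewrite /htwist -(ext_tuple f (map_tuple nu a)).
by rewrite /= ef nuK_inv ext_tuple.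
Qed.

Lemma nu_cocycleP n (f : cochain n) :
  f \in @nu_cocycle _ _ nu n <->
  [/\ multilin (ext f), equivariant nu (ext f) & hdiff (ext f) =1 (fun _ => 0)].
Proof.
split=> [/asboolP[/nu_cochainP[mf ef] df]|[mf ef df]].
  split=> // s; rewrite -ext_hdelta; last exact/multilin_ext.
  by rewrite df ext0.
apply/asboolP; split; first exact/nu_cochainP.
apply: ext_inj => s; rewrite ext_hdelta ?df ?ext0 //; exact/multilin_ext.
Qed.

Lemma cobounds_coboundary d (f : cochain d) :
  cobounds d (ext f) -> is_nu_coboundary nu f.
Proof.
case: d f => [|d] f [G [mG eG fG]].
  apply: ext_inj => s; rewrite ext0; have [s0|sn0] := eqVneq (size s) 0%N;
    last first.
    by rewrite supported_ext.
  rewrite fG // (size0nil s0) /hdiff /conv /contract /insert !cutsum_nil /=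
    mul0r mulr0 scaler0 addr0.
  by rewrite (multilin0 mG [::]) scaler0 subr0.
pose h : cochain d := fun a => G a.
have hG s : size s = d -> ext h s = G s.
  by move=> sd; rewrite -[s]/(tval (Tuple (introT eqP sd))) ext_tuple.
exists h.
  apply/nu_cochainP; split=> [u w c x y|s]; last first.
    have [sd|sd] := eqVneq (size s) d; first by rewrite !hG ?size_map // eG.
    by rewrite !supported_ext ?size_map // linear0.
  have [sd|sd] := eqVneq (size u + size w).+1 d.
    by rewrite !hG ?mG // size_cat /= addnS.
  by rewrite !supported_ext ?size_cat /= ?addnS // scaler0 addr0.
apply/funext => a; rewrite (hdeltaE mG) => [|s sd]; last by rewrite -extE // hG.
by rewrite -fG ?size_tuple // ext_tuple.
Qed.

(** In degree 0 the primitive is 0, for which the odd number 1 serves as degree. *)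
Lemma coboundary_hdiff d (f : cochain d) : is_nu_coboundary nu f ->
  exists p G, [/\ odd d = odd p.+1, multilin G, equivariant nu G, supported p G
                & ext f =1 hdiff G].
Proof.
case: d f => [|d] f /= => [->|[h /nu_cochainP[mh eh] <-]].
  exists 1%N, (fun _ => 0); split=> // [u w c x y|s|s].
  - by rewrite scaler0 addr0.
  - by rewrite linear0.
  rewrite ext0 /hdiff /contract insert0 /conv !cutsum_eq0 ?scaler0 ?subr0
    ?addr0 //.
    by move=> u v _; rewrite mul0r.
  by move=> u v _; rewrite mulr0.
exists d, (ext h); split=> //; first exact: supported_ext.
by apply: ext_hdelta; exact/multilin_ext.
Qed.

End Coboundaries.

Section Frobenius.
Variables (k : fieldType) (R : falgType k) (eps : {linear R -> k^o}) (nu :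
  'AEnd(R)).
Hypotheses (nondeg : nondegenerate_form eps) (nakayama :
  nakayama_automorphism eps nu).
Local Notation cochain n := (n.-tuple R -> R).
Implicit Types (s t u v w : seq R) (F G : seq R -> R) (psi : seq R -> R -> k^o).

Lemma eps_nak a b : eps (a * b) = eps (b * nu a).
Proof. by case: nakayama => _; apply. Qed.

Lemma pairing_inj F G s t :
  (forall a, pairing eps F s a = pairing eps G t a) -> F s = G t.
Proof.
move=> FG; apply/eqP; rewrite -subr_eq0; apply/eqP; apply: nondeg.1 => a.
by rewrite /frob_form mulrBl linearB /= [X in X - _]FG subrr.
Qed.

Lemma pairing_frob_repr psi s a : linear (psi s) ->
  pairing eps (fun s => frob_repr eps (psi s)) s a = psi s a.
Proof.
move=> lin_psi; pose hL := GRing.isLinear.Build k R k^o *:%R (psi s) lin_psi.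
pose L : {linear R -> k^o} := HB.pack (psi s) hL.
exact: (@frob_reprP _ _ eps L nondeg a).
Qed.

(** As the form is nondegenerate, multilinearity and invariance of the functional
    pass to the cochain that represents it. *)
Lemma invariant_pairP psi h : invariant_form nu psi -> pairing eps h =2 psi ->
  multilin h /\ equivariant nu h.
Proof.
move=> [mp lp ep] hp; split=> [u w c x y|s].
  have := @pairing_inj (fun _ => h (u ++ (c *: x + y) :: w))
    (fun _ => c *: h (u ++ x :: w) + h (u ++ y :: w)) [::] [::]; apply=> a.
  rewrite [LHS]hp mp /pairing mulrDl -scalerAl linearP.
  by congr (_ *: _ + _); rewrite -hp.
have := @pairing_inj (fun s => h (map nu s)) (fun s => nu (h s)) s s; apply=> a.
have [nu' _ nuK] := nakayama.1; rewrite -[a]nuK [LHS]hp ep -hp.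
by rewrite /pairing -rmorphM (eps_nu eps_nak).
Qed.

(** The primitive is the cochain that represents [psi]. *)
Lemma cobounds_formdiff d F psi : invariant_form nu psi ->
  (forall s a, size s = d -> pairing eps F s a = formdiff nu psi s a) ->
    cobounds nu d F.
Proof.
move=> ip Fp; pose G s := frob_repr eps (psi s).
have GE : pairing eps G =2 psi by case: ip => _ lp _ s a; exact:
  pairing_frob_repr.
have [mG eG] := invariant_pairP ip GE.
exists G; split=> // s sd; apply: pairing_inj => a.
by rewrite Fp // (pairing_hdiff eps_nak) (eq_formdiff nu GE).
Qed.

(** The i-th summand of Delta is the rotation that cuts the list after i letters. *)
Lemma pairing_hDelta n (f : cochain n) : multilinear f ->
  pairing eps (ext (hDelta eps nu f)) =2 rotsum nu (eps \o ext f).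
Proof.
case: n f => [|n] f mf s a.
  rewrite /pairing (_ : ext _ s = 0) ?mul0r ?linear0; last first.
    by rewrite /ext; case: eqP => // _; rewrite /ev /hDelta big_ord0.
  rewrite /rotsum /cycsum cutsum_eq0 // => u v _ /=.
  by rewrite supported_ext ?linear0 ?scaler0 // size_cat addnS.
have [sn|sn] := eqVneq (size s) n; last first.
  rewrite /pairing supported_ext // mul0r linear0 /rotsum /cycsum cutsum_eq0 //
    => u v sE /=.
  rewrite supported_ext ?linear0 ?scaler0 // size_cat /= size_map addnS eqSS.
  by rewrite addnC -size_cat -sE.
pose T : n.-tuple R := Tuple (introT eqP sn).
rewrite -[s]/(tval T) /pairing ext_tuple /hDelta mulr_suml linear_sum.
rewrite /rotsum /cycsum /cutsum size_tuple; apply: eq_bigr => i _.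
have [in' sT] : (i <= n)%N /\ size T = n by rewrite size_tuple -ltnS.
rewrite -scalerAl linearZ; congr (_ * _).
  apply: sgn_eq; rewrite size_takel ?size_drop ?sT //=.
  by rewrite !oddM oddB //= ; case: (odd i); case: (odd n).
pose psi s x : k^o :=
  frob_form eps (ev f (drop i s ++ x :: [seq nu b | b <- take i s])) 1.
rewrite -[eps _]/(pairing eps (fun s => frob_repr eps (psi s)) T a).
have eT x : ev f (drop i T ++ x :: [seq nu b | b <- take i T]) =
            ext f (drop i T ++ x :: [seq nu b | b <- take i T]).
  by rewrite extE // size_cat /= size_map size_drop size_takel sT // addnS subnK.
rewrite pairing_frob_repr /psi /frob_form ?mulr1 ?eT // => c x y.
by rewrite !mulr1 !eT (multilin_ext f).1 // linearP.
Qed.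

Lemma invariant_rotsum_eps F : multilin F -> equivariant nu F ->
  invariant_form nu (rotsum nu (eps \o F)).
Proof.
move=> mF eF; apply: invariant_rotsum => [|s /=]; first exact: multilin_eps.
by rewrite eF (eps_nu eps_nak).
Qed.

Lemma hDelta_equivariant n (f : cochain n) :
  multilin (ext f) -> equivariant nu (ext f) ->
  multilin (ext (hDelta eps nu f)) /\ equivariant nu (ext (hDelta eps nu f)).
Proof.
move=> mf ef; apply: invariant_pairP (invariant_rotsum_eps mf ef) _.
by apply: pairing_hDelta; exact/multilin_ext.
Qed.

End Frobenius.

(** * The bracket and the BV identity up to homotopy *)

Section Bracket.
Variables (k : fieldType) (R : falgType k) (nu : 'AEnd(R)).
Implicit Types (m n p : nat) (s t u v w : seq R) (F G P : seq R -> R).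

Definition bracket n m F G s : R :=
  insert m G F s - (-1) ^+ (n.+1 * m.+1) *: insert n F G s.

Definition nu_cocycle_ext n F : Prop :=
  [/\ multilin F, equivariant nu F, supported n F & hdiff F =1 (fun _ => 0)].

Lemma bracketC n m F G s :
  bracket n m F G s = - ((-1) ^+ (n.+1 * m.+1) *: bracket m n G F s).
Proof. by rewrite /bracket; lin. Qed.

Lemma equivariant_conv F G :
  equivariant nu F -> equivariant nu G -> equivariant nu (conv F G).
Proof.
move=> eF eG s; rewrite /conv cutsum_map raddf_cutsum; apply: eq_cutsum => u v _.
by rewrite eF eG /= rmorphM.
Qed.

Lemma equivariant_insert m F G :
  equivariant nu F -> equivariant nu G -> equivariant nu (insert m G F).
Proof.
move=> eF eG s; rewrite /insert cutsum_map raddf_cutsum; apply: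
  eq_cutsum => u t _.
rewrite cutsum_map raddf_cutsum; apply: eq_cutsum => x w _.
by rewrite /= linearZ /= -[nu (F _)]eF map_cat /= eG size_map.
Qed.

Lemma insert_l0 m g F s : multilin F -> g =1 (fun _ => 0) -> insert m g F s = 0.
Proof.
move=> mF g0; apply: cutsum_eq0 => u t _; apply: cutsum_eq0 => x w _.
by rewrite g0 multilin0 ?scaler0.
Qed.

Lemma insert_r0 m g F s : F =1 (fun _ => 0) -> insert m g F s = 0.
Proof. by move=> F0; rewrite (eq_insert _ _ F0) insert0. Qed.

Lemma eq_hdiff F G : F =1 G -> hdiff F =1 hdiff G.
Proof. by move=> /funext ->. Qed.

Lemma hdiffZ c F s : hdiff (fun t => c *: F t) s = c *: hdiff F s.
Proof.
(* [hdiff_lin] with the scalar c - 1 avoids the zero cochain. *)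
have E : (fun t => c *: F t) =1 (fun t => (c - 1) *: F t + F t).
  by move=> t; rewrite scalerBl scale1r subrK.
by rewrite (eq_hdiff E) hdiff_lin scalerBl scale1r subrK.
Qed.

Lemma coboundsZ d c F : cobounds nu d F -> cobounds nu d (fun s => c *: F s).
Proof.
move=> [G [mG eG FG]]; exists (fun s => c *: G s); split=> [u w b x y|s|s sd].
- by rewrite mG scalerDr !scalerA mulrC.
- by rewrite eG linearZ.
- by rewrite hdiffZ FG.
Qed.

Lemma hdiff_insert_cocycles n m F G s :
  nu_cocycle_ext n F -> nu_cocycle_ext m G ->
  hdiff (insert m G F) s =
  - ((-1) ^+ m.+1 *: conv G F s) - (-1) ^+ (m * n.+1) *: conv F G s.
Proof.
move=> [mF _ sF dF] [mG _ sG dG]; rewrite (hdiff_insert s mF sF sG).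
by rewrite [insert m G (hdiff F) s]insert_r0 // [insert m.+1 (hdiff G) F
  s]insert_l0 // scaler0 !add0r.
Qed.

(** The cup products in the differentials of the two halves of the bracket cancel. *)
Lemma hdiff_bracket n m F G : nu_cocycle_ext n F -> nu_cocycle_ext m G ->
  hdiff (bracket n m F G) =1 (fun _ => 0).
Proof.
move=> cF cG s.
have E : bracket n m F G =1
    fun s => (- (-1) ^+ (n.+1 * m.+1)) *: insert n F G s + insert m G F s.
  by move=> t; rewrite /bracket scaleNr addrC.
rewrite (eq_hdiff E) hdiff_lin (hdiff_insert_cocycles s cF cG)
  (hdiff_insert_cocycles s cG cF).
by rewrite scaleNr; lin.
Qed.

(** In a combination of f o P and P o f the cup products of [hdiff_insert] cancel,
    which leaves the two halves of the bracket. *)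
Lemma cobounds_bracket n m p d F P : nu_cocycle_ext n F ->
  multilin P -> equivariant nu P -> supported p P -> odd m = odd p.+1 ->
  cobounds nu d (bracket n m F (hdiff P)).
Proof.
move=> [mF eF sF dF] mP eP sP mp.
pose H s := (- (-1) ^+ (n.+1 * p.+1)) *: insert n F P s + insert p P F s.
exists H; split=> [u w c x y|s|s _].
- rewrite /H (multilin_insert p mF mP) (multilin_insert n mP mF) !scalerDr
  !scalerA.
  by rewrite [_ * c]mulrC addrACA.
- by rewrite /H (equivariant_insert p eF eP) (equivariant_insert n eP eF) linearP.
rewrite hdiff_lin (hdiff_insert s mF sF sP) (hdiff_insert s mP sP sF).
rewrite [insert p P (hdiff F) s]insert_r0 // [insert n.+1 (hdiff F) P
  s]insert_l0 // !scaler0.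
rewrite /bracket (eq_insertl _ _ mp (frefl _)).
rewrite (_ : (-1) ^+ (n.+1 * m.+1) = (-1) ^+ (n.+1 * p) :> k); last first.
  by apply: sgn_eq; rewrite !oddM !oddS mp oddS negbK.
by rewrite scaleNr; lin.
Qed.

Lemma cobounds_bracketl n m p d F P : nu_cocycle_ext n F ->
  multilin P -> equivariant nu P -> supported p P -> odd m = odd p.+1 ->
  cobounds nu d (bracket m n (hdiff P) F).
Proof.
move=> cF mP eP sP mp.
apply: eq_cobounds (coboundsZ (- (-1) ^+ (m.+1 * n.+1)) (cobounds_bracket d cF
  mP eP sP mp)) => s _.
by rewrite [RHS]bracketC scaleNr.
Qed.

Lemma cobounds_conv n p d F P : nu_cocycle_ext n F ->
  multilin P -> equivariant nu P -> supported p P ->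
    cobounds nu d (conv F (hdiff P)).
Proof.
move=> [mF eF sF dF] mP eP sP.
have : cobounds nu d (hdiff (conv F P)).
  by exists (conv F P); split=> //; [exact: multilin_conv | exact:
    equivariant_conv].
move/(coboundsZ ((-1) ^+ n)); apply: eq_cobounds => s _.
rewrite (hdiff_conv s sF sP) scalerDr sgnZK [conv (hdiff F) P s]cutsum_eq0
  ?scaler0 ?add0r //.
by move=> u v _; rewrite dF mul0r.
Qed.

Lemma cobounds_convl n p d F P : nu_cocycle_ext n F ->
  multilin P -> equivariant nu P -> supported p P ->
    cobounds nu d (conv (hdiff P) F).
Proof.
move=> [mF eF sF dF] mP eP sP.
have : cobounds nu d (hdiff (conv P F)).
  by exists (conv P F); split=> //; [exact: multilin_conv | exact:
    equivariant_conv].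
apply: eq_cobounds => s _.
rewrite (hdiff_conv s sP sF) [conv P (hdiff F) s]cutsum_eq0 ?scaler0 ?addr0 //.
by move=> u v _; rewrite dF mulr0.
Qed.

Lemma hdiff_conv_cocycles n m F G : nu_cocycle_ext n F -> nu_cocycle_ext m G ->
  hdiff (conv F G) =1 (fun _ => 0).
Proof.
move=> [mF eF sF dF] [mG eG sG dG] s; rewrite (hdiff_conv s sF sG) [conv (hdiff
  F) G s]cutsum_eq0 => [|u v _]; last by rewrite dF mul0r.
rewrite [conv F (hdiff G) s]cutsum_eq0 ?scaler0 ?addr0 // => u v _.
by rewrite dG mulr0.
Qed.

End Bracket.

Section BatalinVilkovisky.
Variables (k : fieldType) (R : falgType k) (nu : 'AEnd(R)) (V : lmodType k).
Variable eps : {linear R -> V}.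
Hypothesis nak : forall a b, eps (a * b) = eps (b * nu a).
Implicit Types (m n l : nat) (s t u v w : seq R) (F G : seq R -> R).

Lemma formdiffZ (psi : seq R -> R -> V) c s a :
  formdiff nu (fun s a => c *: psi s a) s a = c *: formdiff nu psi s a.
Proof.
have E : (fun s a => c *: psi s a) =2 (fun s a => (c - 1) *: psi s a + psi s a).
  by move=> t b; rewrite scalerBl scale1r subrK.
by rewrite (eq_formdiff nu E) formdiff_lin scalerBl scale1r subrK.
Qed.

(** The homotopies for the pairs (G, F) and (F, G), and the one that commutes
    [DG] past [F] in the cup product. *)
Definition bv_homotopy n m l F G (DG : seq R -> R) s a : V :=
  (-1) ^+ (n.+1 * m + n.+1) *: cycsum nu (insert_form eps n G F) s a
  + ((-1) ^+ (n.+1 * m + m * n + m.+1) *: cycsum nu (insert_form eps m F G) s a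
     + (-1) ^+ (n.+1 * m + m * n + m.+1) *: pairing eps (insert l DG F) s a).

(** By [rotsum_conv], the value of Delta at the cup product consists of the cut
    forms of (G, F) and of (F, G). By [formdiff_cycsum_insert_form], each of
    them is, up to its homotopy, a composition and a cup product. The two
    compositions make up the bracket, and [hdiff_insert] turns the product of
    [DG] with [F] into that of [F] with [DG]. The degree of [DG] is
    prescribed only modulo 2 in order to include m = 0, where [DG] vanishes. *)
Lemma bv_identity n m l F G (DF DG DFG : seq R -> R) s a :
  nu_cocycle_ext nu n F -> nu_cocycle_ext nu m G ->
  supported l DG -> odd l = odd m.+1 -> hdiff DG =1 (fun _ => 0) ->
  pairing eps DF =2 rotsum nu (eps \o F) -> pairing eps DG =2
    rotsum nu (eps \o G) ->
  pairing eps DFG =2 rotsum nu (eps \o conv F G) ->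
  pairing eps (fun s => bracket n m F G s + (-1) ^+ (n.+1 * m) *:
     (DFG s - conv DF G s - (-1) ^+ n *: conv F DG s)) s a =
  formdiff nu (bv_homotopy n m l F G DG) s a.
Proof.
move=> [mF eF sF dF] [mG eG sG dG] sDG lm dDG DFE DGE DFGE.
have -> : formdiff nu (bv_homotopy n m l F G DG) s a =
  (-1) ^+ (n.+1 * m + n.+1) *: formdiff nu (cycsum nu (insert_form eps n G F)) s a
  + ((-1) ^+ (n.+1 * m + m * n + m.+1) *: formdiff nu (cycsum nu (insert_form
    eps m F G)) s a
     + (-1) ^+ (n.+1 * m + m * n + m.+1) *: formdiff nu (pairing eps (insert l
       DG F)) s a).
  by rewrite (formdiff_lin nu _ (fun s a => _ *: _ + _ *:
    _)) formdiff_lin formdiffZ.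
rewrite (formdiff_cycsum_insert_form nak mG sG mF sF dF dG s a DGE).
rewrite (formdiff_cycsum_insert_form nak mF sF mG sG dG dF s a DFE).
rewrite -(pairing_hdiff nak).
have dX : hdiff (insert l DG F) s =
    - ((-1) ^+ m *: conv DG F s) - (-1) ^+ (m.+1 * n.+1) *: conv F DG s.
  rewrite (hdiff_insert s mF sF sDG) [insert l DG (hdiff F) s]insert_r0 //.
  rewrite [insert l.+1 (hdiff DG) F s]insert_l0 // scaler0 !add0r.
  by congr (- _ - _); apply: sgnZ; rewrite ?(oddM, oddS) lm ?oddS ?negbK.
have pairE : pairing eps (fun s => bracket n m F G s + (-1) ^+ (n.+1 * m) *:
     (DFG s - conv DF G s - (-1) ^+ n *: conv F DG s)) s a =
  pairing eps (insert m G F) s a - (-1) ^+ (n.+1 * m.+1) *: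
    pairing eps (insert n F G) s a
  + (-1) ^+ (n.+1 * m) *: (pairing eps DFG s a - pairing eps (conv DF G) s a
      - (-1) ^+ n *: pairing eps (conv F DG) s a).
  rewrite /pairing /bracket !(mulrDl, mulNr, =^~scalerAl) !(linearD, linearN,
    linearZ) /=.
  by lin.
rewrite pairE DFGE (rotsum_conv nak s a sF sG eF eG).
have -> : pairing eps (hdiff (insert l DG F)) s a =
    - ((-1) ^+ m *: pairing eps (conv DG F) s a)
    - (-1) ^+ (m.+1 * n.+1) *: pairing eps (conv F DG) s a.
  by rewrite /pairing dX mulrBl mulNr -!scalerAl linearB linearN !linearZ.
lin.
Qed.
End BatalinVilkovisky.

(** * Operations on cohomology *)

Section Lifting.
Variables (k : fieldType) (R : falgType k) (nu : 'AEnd(R)).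
Local Notation cochain n := (n.-tuple R -> R).
Implicit Types (m n p d : nat).

Lemma represents_cocycle n (x : HH nu n) f :
  represents x f -> f \in @nu_cocycle _ _ nu n.
Proof. by case=> z <- _; exact: (valP z). Qed.

Lemma represents_hclass n (f : cochain n) (cf : f \in @nu_cocycle _ _ nu n) :
  represents (hclass (Cocycle cf)) f.
Proof. by exists (Cocycle cf). Qed.

Lemma represents_lin n c (x y : HH nu n) f g :
  represents x f -> represents y g -> represents (c *: x + y) (c *: f + g).
Proof.
move=> [u <- <-] [v <- <-]; exists (c *: u + v) => //.
by rewrite /hclass lclassD -lclassZ.
Qed.

Lemma represents0 n : represents (0 : HH nu n) 0.
Proof.
have [f xf] := represents_ex (0 : HH nu n).
by have := represents_lin (-1) xf xf; rewrite !scaleN1r !addNr.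
Qed.

Lemma lift1 n p (op : cochain n -> cochain p) :
  (forall f, f \in @nu_cocycle _ _ nu n -> op f \in @nu_cocycle _ _ nu p) ->
  (forall f f', f \in @nu_cocycle _ _ nu n -> f' \in @nu_cocycle _ _ nu n ->
     is_nu_coboundary nu (f - f') -> is_nu_coboundary nu (op f - op f')) ->
  {D : HH nu n -> HH nu p |
    forall a f, represents a f -> represents (D a) (op f)}.
Proof.
move=> opc opb.
pose rep (x : HH nu n) := sval (cid (represents_ex x)).
have repP x : represents x (rep x) := svalP (cid (represents_ex x)).
exists (fun a => hclass (Cocycle (opc _ (represents_cocycle (repP a))))) =>
  a f af.
have cf := represents_cocycle af.
have E := (represents_eq (represents_hclass (opc _ cf))
  (represents_hclass (opc _ (represents_cocycle (repP a))))).2.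
rewrite -E; first exact: represents_hclass.
apply: opb => //; first exact: represents_cocycle (repP a).
exact: (represents_eq af (repP a)).1.
Qed.

Lemma lift2 n m p (op : cochain n -> cochain m -> cochain p) :
  (forall f g, f \in @nu_cocycle _ _ nu n -> g \in @nu_cocycle _ _ nu m ->
     op f g \in @nu_cocycle _ _ nu p) ->
  (forall f f' g, f \in @nu_cocycle _ _ nu n -> f' \in @nu_cocycle _ _ nu n ->
     g \in @nu_cocycle _ _ nu m ->
     is_nu_coboundary nu (f - f') -> is_nu_coboundary nu (op f g - op f' g)) ->
  (forall f g g', f \in @nu_cocycle _ _ nu n -> g \in @nu_cocycle _ _ nu m ->
     g' \in @nu_cocycle _ _ nu m ->
     is_nu_coboundary nu (g - g') -> is_nu_coboundary nu (op f g - op f g')) ->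
  {c : HH nu n -> HH nu m -> HH nu p |
    forall a b f g, represents a f -> represents b g ->
      represents (c a b) (op f g)}.
Proof.
move=> opc opl opr.
pose rep (x : HH nu n) := sval (cid (represents_ex x)).
have repP x : represents x (rep x) := svalP (cid (represents_ex x)).
have repc x := represents_cocycle (repP x).
have lift_r x := lift1 (fun g => opc _ g (repc x))
    (fun g g' => opr _ g g' (repc x)).
exists (fun a b => sval (lift_r a) b) => a b f g af bg.
have cf := represents_cocycle af; have cg := represents_cocycle bg.
have -> : sval (lift_r a) b = hclass (Cocycle (opc _ _ cf cg)).
  apply/(represents_eq (svalP (lift_r a) b g bg) (represents_hclass _)).
  by apply: opl => //; exact: (represents_eq (repP a) af).1.
exact: represents_hclass.
Qed.

Lemma HHin_lin n c (x y : HH nu n) : HHin (c *: x + y) = c *: HHin x + HHin y.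
Proof.
apply: dsum_ext => i; rewrite /HHin /homog.
rewrite -[RHS]/(c *: homog_fun x i + homog_fun y i) /= /homog_fun.
case: eqVneq => [e|_]; last by rewrite scaler0 addr0.
by case: i / e.
Qed.

Lemma HHin0 n : HHin (0 : HH nu n) = 0.
Proof.
by have := HHin_lin (-1) (0 : HH nu n) 0; rewrite scaler0 addr0 scaleN1r addNr.
Qed.

(** The summands of the identity live in degrees such as n.-1 + m and
    (n + m).-1, which agree only propositionally, and fail to agree just when a
    truncated predecessor of 0 occurs; the cochain is then 0. *)
Lemma HHin_transport p d (x : HH nu p) (f : cochain p) : represents x f ->
  p = d \/ ext f =1 (fun _ => 0) ->
  exists y (f' : cochain d), [/\ HHin y = HHin x,
    represents y f' & ext f' =1 ext f].
Proof.
move=> xf [pd|f0]; first by case: d / pd; exists x, f.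
have f00 : f = 0 by apply: ext_inj => s; rewrite f0 ext0.
exists 0, 0; split; [|exact: represents0|by move=> s; rewrite f0 ext0].
have -> : x = 0.
  apply/(represents_eq xf (represents0 p)); rewrite f00.
  exact: (represents_eq (represents0 p) (represents0 p)).1 erefl.
by rewrite !HHin0.
Qed.
End Lifting.

Section Operations.
Variables (k : fieldType) (R : falgType k) (eps : {linear R -> k^o}) (nu :
  'AEnd(R)).
Hypotheses (nondeg : nondegenerate_form eps) (nakayama :
  nakayama_automorphism eps nu).
Local Notation cochain n := (n.-tuple R -> R).
Implicit Types (m n p d : nat).

Lemma nu_cocycle_extP n (f : cochain n) :
  f \in @nu_cocycle _ _ nu n <-> nu_cocycle_ext nu n (ext f).
Proof.
split=> [/(nu_cocycleP nakayama.1)[mf ef df]|[mf ef _ df]].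
  by split=> //; exact: supported_ext.
by apply/(nu_cocycleP nakayama.1).
Qed.

Lemma nu_cocycle_eq n (f : cochain n) F :
  ext f =1 F -> multilin F -> equivariant nu F ->
  hdiff F =1 (fun _ => 0) -> f \in @nu_cocycle _ _ nu n.
Proof. by move=> /funext <- mF eF dF; apply/(nu_cocycleP nakayama.1). Qed.

Lemma coboundary_cobounds n (f : cochain n) F : ext f =1 F -> cobounds nu n F ->
  is_nu_coboundary nu f.
Proof. by move=> /funext <-; exact: (cobounds_coboundary nakayama.1). Qed.

Lemma multilin_bracket n m F G :
  multilin F -> multilin G -> multilin (@bracket k R n m F G).
Proof.
move=> mF mG u w c x y; rewrite /bracket !multilin_insert // !scalerBr
  !scalerDr !scalerA.
rewrite [_ * c]mulrC; zmod.
Qed.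

Lemma equivariant_bracket n m F G : equivariant nu F -> equivariant nu G ->
  equivariant nu (bracket n m F G).
Proof.
move=> eF eG s; rewrite /bracket (equivariant_insert m eF eG)
  (equivariant_insert n eG eF).
by rewrite [RHS]linearB /= [nu (_ *: _)]linearZ.
Qed.

Lemma hcup_lift n m : {c : HH nu n -> HH nu m -> HH nu (n + m) |
  forall a b f g, represents a f -> represents b g ->
    represents (c a b) (hcup f g)}.
Proof.
apply: lift2 => [f g /nu_cocycle_extP cf /nu_cocycle_extP cg
  |f f' g _ _ /nu_cocycle_extP cg|f g g' /nu_cocycle_extP cf _ _].
- have [[mf ef _ _] [mlg eg _ _]] := (cf, cg).
  apply: nu_cocycle_eq (ext_hcup f g) (multilin_conv mf mlg) (equivariant_conv
    ef eg) _.
  exact: hdiff_conv_cocycles cf cg.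
- move=> /(coboundary_hdiff nakayama.1)[p [P [_ mP eP sP fE]]].
  apply: coboundary_cobounds (cobounds_convl (n + m) cg mP eP sP) => s.
  rewrite extB !ext_hcup /conv -cutsumB; apply: eq_cutsum => u v _.
  by rewrite -mulrBl -extB fE.
- move=> /(coboundary_hdiff nakayama.1)[p [P [_ mP eP sP fE]]].
  apply: coboundary_cobounds (cobounds_conv (n + m) cf mP eP sP) => s.
  rewrite extB !ext_hcup /conv -cutsumB; apply: eq_cutsum => u v _.
  by rewrite -mulrBr -extB fE.
Qed.

Lemma hbracket_lift n m : {c : HH nu n -> HH nu m -> HH nu (n + m).-1 |
  forall a b f g, represents a f -> represents b g ->
    represents (c a b) (hbracket f g)}.
Proof.
apply: lift2 => [f g /nu_cocycle_extP cf /nu_cocycle_extP cg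
  |f f' g /nu_cocycle_extP cf /nu_cocycle_extP cf' /nu_cocycle_extP cg
  |f g g' /nu_cocycle_extP cf /nu_cocycle_extP cg /nu_cocycle_extP cg'].
- have [[mf ef _ _] [mlg eg _ _]] := (cf, cg).
  apply: (nu_cocycle_eq (F := bracket n m (ext f) (ext g))).
  + by apply: ext_hbracket; apply/multilin_ext.
  + exact: multilin_bracket.
  + exact: equivariant_bracket.
  + exact: hdiff_bracket cf cg.
- move=> /(coboundary_hdiff nakayama.1)[p [P [np mP eP sP fE]]].
  apply: coboundary_cobounds (cobounds_bracketl (n + m).-1 cg mP eP sP np) => s.
  have [[mf _ _ _] [mf' _ _ _] [mlg _ _ _]] := And3 cf cf' cg.
  have [/multilin_ext Mf /multilin_ext Mf' /multilin_ext Mg] := And3 mf mf' mlg.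
  rewrite extB !ext_hbracket // /bracket.
  have E : hdiff P = fun t => (-1) *: ext f' t + ext f t.
    by apply/funext => t; rewrite -fE extB scaleN1r addrC.
  rewrite E insert_lin insert_linl //.
  lin.
- move=> /(coboundary_hdiff nakayama.1)[p [P [np mP eP sP fE]]].
  apply: coboundary_cobounds (cobounds_bracket (n + m).-1 cf mP eP sP np) => s.
  have [[mf _ _ _] [mlg1 _ _ _] [mlg2 _ _ _]] := And3 cf cg cg'.
  have [/multilin_ext Mf /multilin_ext Mg /multilin_ext Mg'] := And3 mf mlg1 mlg2.
  rewrite extB !ext_hbracket // /bracket.
  have E : hdiff P = fun t => (-1) *: ext g' t + ext g t.
    by apply/funext => t; rewrite -fE extB scaleN1r addrC.
  rewrite E insert_lin insert_linl //.
  lin.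
Qed.

Lemma hdiff_hDelta n (f : cochain n) : nu_cocycle_ext nu n (ext f) ->
  hdiff (ext (hDelta eps nu f)) =1 (fun _ => 0).
Proof.
move=> [mf ef sf df] s; apply: (pairing_inj nondeg (s := s) (t := s) (G :=
  fun _ => 0)) => a.
rewrite (pairing_hdiff (eps_nak nakayama)).
rewrite (eq_formdiff nu (pairing_hDelta nu nondeg ((multilin_ext f).2 mf))).
apply: oppr_inj; rewrite -(rotsum_hdiff (eps_nak nakayama)) // /pairing mul0r
  linear0 oppr0.
by apply: cutsum_eq0 => u v _ /=; rewrite df linear0 scaler0.
Qed.

Lemma hDelta_lift n : {D : HH nu n -> HH nu n.-1 |
  forall a f, represents a f -> represents (D a) (hDelta eps nu f)}.
Proof.
apply: lift1 => [f /nu_cocycle_extP cf|f f' /nu_cocycle_extP cf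
  /nu_cocycle_extP cf'].
  have [mf ef _ _] := cf.
  have [mD eD] := hDelta_equivariant nondeg nakayama mf ef.
  exact: nu_cocycle_eq (frefl _) mD eD (hdiff_hDelta cf).
move=> /(coboundary_hdiff nakayama.1)[p [P [np mP eP sP fE]]].
apply: coboundary_cobounds (frefl _) _.
have nak := eps_nak nakayama.
have [[mf ef _ _] [mf' ef' _ _]] := (cf, cf').
have ip := invariant_rotsum_eps nakayama mP eP.
have E h : multilin (ext h) -> pairing eps (ext (hDelta eps nu h)) =2
  rotsum nu (eps \o ext h).
  by move=> mh; apply: pairing_hDelta => //; exact/multilin_ext.
suff /(coboundsZ (-1)) : cobounds nu n.-1 (fun s =>
  ext (hDelta eps nu f') s - ext (hDelta eps nu f) s).
  by apply: eq_cobounds => s _; rewrite extB scaleN1r opprB.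
apply: (cobounds_formdiff nondeg nakayama ip) => s a _.
apply: oppr_inj; rewrite -(rotsum_hdiff nak) // /pairing mulrBl linearB opprB.
rewrite -![eps (ext _ s * a)]/(pairing eps (ext _) s a) !E // /rotsum /cycsum
  -cutsumB.
by apply: eq_cutsum => u v _; rewrite /= -fE extB linearB scalerBr.
Qed.

End Operations.

Section Relations.
Variables (k : fieldType) (R : falgType k) (eps : {linear R -> k^o}) (nu :
  'AEnd(R)).
Hypotheses (nondeg : nondegenerate_form eps) (nakayama :
  nakayama_automorphism eps nu).
Local Notation cochain n := (n.-tuple R -> R).
Local Notation Delta := (hDelta eps nu).
Implicit Types (m n p d : nat).

(** The primitive is the one of [formdiff_rotsum_cons1]. *)
Lemma hDelta_hDelta_coboundary n (f : cochain n) : nu_cocycle_ext nu n (ext f) ->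
  is_nu_coboundary nu (Delta (Delta f)).
Proof.
move=> cf; have [mf ef _ _] := cf; have nak := eps_nak nakayama.
have [mD eD] := hDelta_equivariant nondeg nakayama mf ef.
apply: (coboundary_cobounds nakayama (frefl _)).
have mD1 : multilin (fun w => ext (Delta f) (1 :: w)).
  exact: (@multilin_catl _ _ _ _ mD [:: 1]).
have eD1 : equivariant nu (fun w => ext (Delta f) (1 :: w)).
  by move=> w; rewrite -eD /= rmorph1.
apply: (cobounds_formdiff nondeg nakayama (invariant_rotsum_eps nakayama mD1
  eD1)) => s a _.
rewrite pairing_hDelta //; last exact/multilin_ext.
rewrite (formdiff_rotsum_cons1 nak s a ef mD) //; last exact: hdiff_hDelta.
by apply: pairing_hDelta => //; exact/multilin_ext.
Qed.

Lemma bv_coboundary n m (f : cochain n) (g : cochain m) :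
  nu_cocycle_ext nu n (ext f) -> nu_cocycle_ext nu m (ext g) ->
  cobounds nu (n + m).-1 (fun s => bracket n m (ext f) (ext g) s + (-1) ^+
    (n.+1 * m) *:
    (ext (Delta (hcup f g)) s - conv (ext (Delta f)) (ext g) s
     - (-1) ^+ n *: conv (ext f) (ext (Delta g)) s)).
Proof.
move=> cf cg; have [[mf ef sf df] [mlg eg sg dg]] := (cf, cg).
have nak := eps_nak nakayama.
have pairD p (h : cochain p) : multilin (ext h) ->
  pairing eps (ext (Delta h)) =2 rotsum nu (eps \o ext h).
  by move=> mh; apply: pairing_hDelta => //; exact/multilin_ext.
have [mD eD] := hDelta_equivariant nondeg nakayama mlg eg.
have [l sl lm] : exists2 l, supported l (ext (Delta g)) & odd l = odd m.+1.
  case: m g {cg mlg eg sg dg mD eD} => [|m] g.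
    exists 1%N => // s _; rewrite /ext; case: eqP => // _.
    by rewrite /ev /hDelta big_ord0.
  by exists m; [exact: supported_ext | rewrite /= negbK].
apply: (cobounds_formdiff nondeg nakayama (psi :=
  bv_homotopy nu eps n m l (ext f) (ext g) (ext (Delta g)))).
  apply: invariant_form_lin; first exact: invariant_insert_form.
  apply: invariant_form_lin; first exact: invariant_insert_form.
  have [m1 l1 e1] := invariant_pairing nak (multilin_insert l mf mD)
    (equivariant_insert l ef eD).
  split=> [a u w c x y|s c x y|s a].
  - by rewrite m1 scalerDr !scalerA mulrC.
  - by rewrite l1 scalerDr !scalerA mulrC.
  - by rewrite e1.
move=> s a _; apply: bv_identity => //.
- exact: hdiff_hDelta.
- exact: pairD.
- exact: pairD.
- by move=> t b; rewrite pairD ?(funext (ext_hcup f g)) //; exact: multilin_conv.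
Qed.

End Relations.

Theorem theorem2 (k : closedFieldType) (R : falgType k)
    (eps : {linear R -> k^o}) (nu : 'AEnd(R))
    (eps_nondeg : nondegenerate_form eps)
    (nu_nakayama : nakayama_automorphism eps nu) :
  exists (cup : forall n m, HH nu n -> HH nu m -> HH nu (n + m))
         (br : forall n m, HH nu n -> HH nu m -> HH nu (n + m).-1)
         (D : forall n, HH nu n -> HH nu n.-1),
  [/\ (forall n m (a : HH nu n) (b : HH nu m) f g,
         represents a f -> represents b g ->
         represents (cup n m a b) (hcup f g)),
      (forall n m (a : HH nu n) (b : HH nu m) f g,
         represents a f -> represents b g ->
         represents (br n m a b) (hbracket f g)),
      (forall n (a : HH nu n) f,
         represents a f -> represents (D n a) (hDelta eps nu f)),
      (forall n (a : HH nu n), D n.-1 (D n a) = 0)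
    & (forall n m (a : HH nu n) (b : HH nu m),
         HHin (br n m a b) =
         - ((-1) ^+ (n.+1 * m) *:
            (HHin (D (n + m)%N (cup n m a b))
             - HHin (cup n.-1 m (D n a) b)
             - (-1) ^+ n *: HHin (cup n m.-1 a (D m b)))))].
Proof.
have cocycleP n (x : HH nu n) f : represents x f -> nu_cocycle_ext nu n (ext f).
  by move/represents_cocycle/(nu_cocycle_extP nu_nakayama).
pose cup n m := sval (hcup_lift nu_nakayama n m).
have cupP n m : forall a b f g, represents a f -> represents b g ->
  represents (cup n m a b) (hcup f g) := svalP (hcup_lift nu_nakayama n m).
pose br n m := sval (hbracket_lift nu_nakayama n m).
have brP n m : forall a b f g, represents a f -> represents b g ->
  represents (br n m a b) (hbracket f g) := svalP (hbracket_lift nu_nakayama n m).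
pose D n := sval (hDelta_lift eps_nondeg nu_nakayama n).
have DP n : forall a f, represents a f -> represents (D n a) (hDelta eps nu f) :=
  svalP (hDelta_lift eps_nondeg nu_nakayama n).
exists cup, br, D; split=> //.
  move=> n a; have [f af] := represents_ex a.
  apply/(represents_eq (DP _ _ _ (DP _ _ _ af)) (represents0 nu _));
    rewrite subr0.
  by apply: hDelta_hDelta_coboundary => //; exact: cocycleP af.
move=> n m a b; have [[f af] [g bg]] := (represents_ex a, represents_ex b).
have [cf cg] := (cocycleP _ _ _ af, cocycleP _ _ _ bg).
have hDelta0 p (h : p.-tuple R -> R) : p = 0%N -> ext (hDelta eps nu h) =1
  (fun _ => 0).
  move=> p0 s; rewrite /ext; case: eqP => // _; rewrite /ev /hDelta.
  by rewrite big1 // => i; have := ltn_ord i; rewrite {2}p0.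
have [|y1 [f1 [<- y1f1 f1E]]] :=
    @HHin_transport _ _ _ _ (n + m).-1 _ _ (cupP _ _ _ _ _ _ (DP _ _ _ af) bg).
  case: (posnP n) => [n0|n_gt0]; [right=> s|by left; case: (n) n_gt0].
  by rewrite ext_hcup; apply: cutsum_eq0 => u v _; rewrite hDelta0 ?mul0r.
have [|y2 [f2 [<- y2f2 f2E]]] :=
    @HHin_transport _ _ _ _ (n + m).-1 _ _ (cupP _ _ _ _ _ _ af (DP _ _ _ bg)).
  case: (posnP m) => [m0|m_gt0]; [right=> s|by left; case: (m) m_gt0 =>
    // ? _; rewrite addnS].
  by rewrite ext_hcup; apply: cutsum_eq0 => u v _; rewrite hDelta0 ?mulr0.
set x := D (n + m)%N (cup n m a b).
have xP : represents x (hDelta eps nu (hcup f g)) :=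
  DP _ _ _ (cupP _ _ _ _ _ _ af bg).
set c : k := (-1) ^+ (n.+1 * m); set e : k := (-1) ^+ n.
have WP := represents_lin c (represents_lin (- e) y2f2 (represents_lin (-1)
  y1f1 xP))
  (brP _ _ _ _ _ _ af bg).
have W0 : c *: (- e *: y2 + (-1 *: y1 + x)) + br n m a b = 0.
  apply/(represents_eq WP (represents0 nu _)); rewrite subr0.
  apply: (cobounds_coboundary nu_nakayama.1).
  apply: eq_cobounds (bv_coboundary eps_nondeg nu_nakayama cf cg) => s _.
  have [[mlf _ _ _] [mlg _ _ _]] := (cf, cg).
  have [/multilin_ext Mf /multilin_ext Mg] := conj mlf mlg.
  rewrite !ext_lin f1E f2E !ext_hcup ext_hbracket // [LHS]addrC /bracket.
  congr (_ *: _ + _); rewrite scaleN1r scaleNr; zmod.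
have := congr1 (@HHin _ _ _ _) W0; rewrite !HHin_lin HHin0 => /eqP.
rewrite addrC addr_eq0 => /eqP ->; congr (- (_ *: _)).
by rewrite scaleN1r scaleNr; zmod.
Qed.
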